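(* Let $G$ be a bipartite graph. Then $k[G]$ is a complete intersection if and only if $G$ is a CI graph, i.e. if and only if any two (distinct) cycles with no chords in $G$ have at most one edge in common.
   Context: Graphs are finite and simple, and $k$ is a field. For a graph $G$ with vertices $x_1,\dots,x_N$, let $E(G)$ be its set of edges. The edge algebra $k[G]$ is the subalgebra of the polynomial ring $k[x_1,\dots,x_N]$ generated by the monomials $x_ix_j$ with $(x_i,x_j)$ an edge of $G$. Let $k[E(G)]$ be the polynomial ring whose variables are the edges of $G$, let $\phi:k[E(G)]\to k[G]$ be the $k$-algebra map sending the edge $(x_r,x_s)$ to $x_rx_s$, and let $K_G=\ker\phi$, so $k[G]\cong k[E(G)]/K_G$. ''$k[G]$ is a complete intersection'' means that $K_G$ can be generated by $|E(G)|-\dim k[G]$ elements (its height), where $\dim$ is Krull dimension. A cycle of length $l\ge 3$ is a closed walk with $l$ edges passing through $l$ distinct vertices; cycles are identified with the corresponding subgraphs. A chord of a cycle is an edge of $G$ joining two vertices of the cycle which is not an edge of the cycle. A bipartite graph $G$ is called a CI graph if any two (distinct) cycles with no chords have at most one edge in common. *)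

(* Defs.v *)
From HB Require Import structures.
From mathcomp Require Import all_boot all_algebra.
From mathcomp Require Import mpoly boolp.

Set Implicit Arguments.
Unset Strict Implicit.
Unset Printing Implicit Defensive.

Import GRing.Theory.
Local Open Scope ring_scope.

(* Prime ideals are boolean predicates; since [boolp] makes every proposition
   boolean, [prime_idealr R] covers all the prime ideals of [R]. *)
Definition prime_chain (R : comNzRingType) (d : nat)
    (P : 'I_d.+1 -> prime_idealr R) : Prop :=
  forall i j : 'I_d.+1, (i < j)%N ->
    {subset P i <= P j} /\ exists2 x, x \in P j & x \notin P i.

Definition has_krull_dim (R : comNzRingType) (d : nat) : Prop :=
  (exists P : 'I_d.+1 -> prime_idealr R, prime_chain P) /\
  forall (n : nat) (P : 'I_n.+1 -> prime_idealr R), prime_chain P -> (n <= d)%N.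

Definition generates_ideal (R : comNzRingType) (h : nat) (s : h.-tuple R)
    (I : R -> Prop) : Prop :=
  forall x, I x <-> exists c : h.-tuple R, x = \sum_(i < h) tnth c i * tnth s i.

Definition simple_graph (N : nat) (e : rel 'I_N) : Prop :=
  ssrbool.symmetric e /\ irreflexive e.

Definition bipartite (N : nat) (e : rel 'I_N) : Prop :=
  exists A : {set 'I_N}, forall x y, e x y -> (x \in A) != (y \in A).

Definition edges (N : nat) (e : rel 'I_N) : {set {set 'I_N}} :=
  [set [set x; y] | x in 'I_N, y in 'I_N & e x y].

Definition edge_mon (k : fieldType) (N : nat) (E : {set 'I_N}) : {mpoly k[N]} :=
  \prod_(i in E) 'X_i.

Definition in_edge_alg (k : fieldType) (N : nat) (e : rel 'I_N) :
    {pred {mpoly k[N]}} :=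
  fun p => `[< forall S : {pred {mpoly k[N]}}, subalg_closed S ->
                 {in edges e, forall E, edge_mon k E \in S} -> p \in S >].
Arguments in_edge_alg k {N} e _.

Lemma in_edge_alg_subalg (k : fieldType) (N : nat) (e : rel 'I_N) :
  subalg_closed (in_edge_alg k e).
Proof.
split.
- by apply/asboolP => S [].
- move=> a u v /asboolP uP /asboolP vP; apply/asboolP => S clS SE.
  by have [_ lin _] := clS; apply: lin; [apply: uP | apply: vP].
- move=> u v /asboolP uP /asboolP vP; apply/asboolP => S clS SE.
  by have [_ _ mul] := clS; apply: mul; [apply: uP | apply: vP].
Qed.

HB.instance Definition _ (k : fieldType) (N : nat) (e : rel 'I_N) :=
  GRing.isSubalgClosed.Build k {mpoly k[N]} (in_edge_alg k e)
    (GRing.subalg_closed_semi (in_edge_alg_subalg k e)).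

Record edge_alg (k : fieldType) (N : nat) (e : rel 'I_N) : Type := EdgeAlg {
  edge_alg_val :> {mpoly k[N]};
  edge_alg_valP : edge_alg_val \in in_edge_alg k e }.

HB.instance Definition _ (k : fieldType) (N : nat) (e : rel 'I_N) :=
  [isSub for @edge_alg_val k N e].
HB.instance Definition _ (k : fieldType) (N : nat) (e : rel 'I_N) :=
  [Choice of edge_alg k e by <:].
HB.instance Definition _ (k : fieldType) (N : nat) (e : rel 'I_N) :=
  [SubChoice_isSubComNzRing of edge_alg k e by <:].
HB.instance Definition _ (k : fieldType) (N : nat) (e : rel 'I_N) :=
  [SubZmodule_isSubLmodule of edge_alg k e by <:].
HB.instance Definition _ (k : fieldType) (N : nat) (e : rel 'I_N) :=
  [SubNzRing_SubLmodule_isSubLalgebra of edge_alg k e by <:].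
HB.instance Definition _ (k : fieldType) (N : nat) (e : rel 'I_N) :=
  [SubLalgebra_isSubAlgebra of edge_alg k e by <:].

Lemma edge_mon_in (k : fieldType) (N : nat) (e : rel 'I_N) :
  {in edges e, forall E, edge_mon k E \in in_edge_alg k e}.
Proof. by move=> E EE; apply/asboolP => S _; apply. Qed.

(* [{mpoly k[#|edges e|]}] is $k[E(G)]$: its variable ['X_i] stands for the
   edge [enum_val i]. *)
Definition edge_gen (k : fieldType) (N : nat) (e : rel 'I_N)
    (i : 'I_#|edges e|) : edge_alg k e :=
  EdgeAlg (edge_mon_in k (enum_valP i)).

Definition edge_map (k : fieldType) (N : nat) (e : rel 'I_N) :
    {mpoly k[#|edges e|]} -> edge_alg k e :=
  mmap (in_alg (edge_alg k e)) (@edge_gen k N e).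
Arguments edge_map k {N} e _.

Definition complete_intersection (k : fieldType) (N : nat) (e : rel 'I_N) :
    Prop :=
  exists d h : nat, [/\ has_krull_dim (edge_alg k e) d, (h + d = #|edges e|)%N &
    exists s : h.-tuple {mpoly k[#|edges e|]},
      generates_ideal s (fun p => edge_map k e p = 0)].

Definition graph_cycle (N : nat) (e : rel 'I_N) (c : seq 'I_N) : Prop :=
  ucycle e c /\ (3 <= size c)%N.

Definition cycle_edges (N : nat) (c : seq 'I_N) : {set {set 'I_N}} :=
  [set [set x; next c x] | x in c].

Definition chordless (N : nat) (e : rel 'I_N) (c : seq 'I_N) : Prop :=
  forall x y, x \in c -> y \in c -> e x y -> [set x; y] \in cycle_edges c.

(* A cycle of length at least 3, as a subgraph, is determined by its set of
   edges; hence two vertex sequences are different cycles when their edge sets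
   differ. *)
Definition CI_graph (N : nat) (e : rel 'I_N) : Prop :=
  forall c1 c2 : seq 'I_N,
    graph_cycle e c1 -> chordless e c1 ->
    graph_cycle e c2 -> chordless e c2 ->
    cycle_edges c1 <> cycle_edges c2 ->
    (#|cycle_edges c1 :&: cycle_edges c2| <= 1)%N.

(* Main.v *)
Require Import Defs.
From HB Require Import structures.
From mathcomp Require Import all_boot all_algebra.
From mathcomp Require Import mpoly boolp zify ring.

(** Write [r] for the number of vertices minus the number of connected
    components. Two numbers are compared throughout: the number [n] of chordless
    cycles and [#|edges e| - r], the dimension of the cycle space.

    The Krull dimension of the edge algebra is [r]. A chain of [r + 1] primes
    arises by deleting the vertices one at a time, from the leaves of a spanning
    forest to its roots ([krull_chain]). Conversely a chain of [m + 1] primes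
    yields [m] algebraically independent elements ([prime_chain_independent]),
    whereas a monomial of the edge algebra is determined by its exponents at
    the [r] vertices which are not roots, so that there are too few monomials of
    bounded degree if [m > r] ([krull_le]). Hence complete intersection means
    that the kernel [K] is generated by [#|edges e| - r] elements.

    The least number of generators of [K] is [n]. Each cycle has two perfect
    matchings, whose difference is a binomial of [K]. Two monomials with the same
    image differ by exchanging such matchings along cycles, and a chord
    splits an exchange into two exchanges along shorter cycles: the binomials of
    the chordless cycles generate [K] ([fiber_connected],
    [cycle_generators_generate]). None can be spared, since a chordless
    cycle has only these two matchings: the coefficient on one of them is a
    functional on [K] which kills the products of [K] with the maximal ideal and
    tells the chordless cycles apart ([chordless_le_generators]).

    The same connectedness of the fibers shows that the chordless cycles, as
    vectors of alternating signs indexed by the edges, span the rational cycle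
    space. So [n >= #|edges e| - r], and it remains to see that the chordless
    cycles are linearly independent exactly when the graph is CI. The pivot is
    the notion of a bridge of a cycle: a walk off the cycle which joins two
    nonadjacent vertices of it.
    - If two chordless cycles share two edges, one of them has a bridge
      ([shared_edges_bridged]). A bridge writes the cycle as the sum of two
      vectors of the cycle space, each supported on fewer of its vertices; their
      decompositions do not use the cycle, which is thus redundant
      ([bridged_chordless_gt]).
    - In a CI graph no chordless cycle has a bridge ([CI_not_bridged]). Then
      each connected piece of the rest of the graph is attached to the ends of
      at most one edge of the cycle, and the flow out of a vertex of the cycle
      towards one side is a linear form which vanishes on all the other chordless
      cycles ([CI_chordless_le]). *)

Set Implicit Arguments.
Unset Strict Implicit.
Unset Printing Implicit Defensive.

(** * Cyclic sequences *)

Lemma next_cat (T : eqType) (s1 s2 : seq T) z w :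
  uniq (s1 ++ z :: w :: s2) -> next (s1 ++ z :: w :: s2) z = w.
Proof.
move=> us; rewrite -(next_rot (size s1) us) rot_size_cat /=.
by rewrite eqxx.
Qed.

Lemma next_last (T : eqType) (s : seq T) z w :
  uniq (w :: rcons s z) -> next (w :: rcons s z) z = w.
Proof.
move=> us; rewrite -(next_rot (size (w :: s)) us).
rewrite -rcons_cons -cats1 rot_size_cat /=.
by rewrite eqxx.
Qed.

Lemma next_closed (T : eqType) (c : seq T) (P : T -> Prop) x :
  uniq c -> x \in c -> P x -> (forall z, z \in c -> P z -> P (next c z)) ->
  forall z, z \in c -> P z.
Proof.
move=> uc xc Px cl; have [i q cE] := rot_to xc.
have := cycle_next uc; rewrite -(rot_cycle i) cE /= => cy.
have: forall z, z \in x :: rcons q x -> P z.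
  have: x \in c by []; move: (x) (rcons q x) cy Px.
  move=> y s; elim: s y => [|w s IH] y /= => [_ Py _ z|/andP[/eqP <- ps] Py yc z].
    by rewrite inE => /eqP->.
  rewrite inE => /orP[/eqP->//|]; apply: IH ps _ _ z; first exact: cl.
  by rewrite mem_next.
move=> H z zc; apply: H; rewrite -rcons_cons mem_rcons inE -cE mem_rot zc.
by rewrite orbT.
Qed.

Lemma next_injective (T : eqType) (c : seq T) : uniq c -> injective (next c).
Proof. by move=> uc; apply: can_inj (prev_next uc). Qed.

Lemma next_rcons (T : eqType) (s s2 : seq T) w z : uniq (s ++ w :: s2) ->
  z \in s -> next (s ++ w :: s2) z = next (rcons s w) z.
Proof.
move=> us zs; have: uniq (s ++ [:: w]).
  by move: us; rewrite -cat1s catA cat_uniq => /andP[].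
by case/splitPr: zs us => s1 [|z' s3]; rewrite -cats1 -!catA /= => us us';
  rewrite !next_cat.
Qed.

Lemma next_neq_prev (T : eqType) (c : seq T) x :
  uniq c -> 2 < size c -> x \in c -> next c x != prev c x.
Proof.
move=> uc sc xc; have [i q cE] := rot_to xc.
rewrite -(next_rot i uc) -(prev_rot i uc).
move: sc uc; rewrite -(size_rot i) -(rot_uniq i) {}cE => sc uc.
case: q uc sc => [//|y q] uc; case/lastP: q uc => [//|q z] uc _.
have -> : next (x :: y :: rcons q z) x = y by rewrite /= eqxx.
have -> : prev (x :: y :: rcons q z) x = z.
  apply: (next_injective uc); rewrite next_prev //.
  by rewrite -rcons_cons next_last.
by case/and3P: uc => _; rewrite mem_rcons inE negb_or => /andP[].
Qed.

Lemma set2_inj (T : finType) (x y z w : T) :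
  [set x; y] = [set z; w] -> (x = z /\ y = w) \/ (x = w /\ y = z).
Proof.
move=> E.
have: x \in [set z; w] by rewrite -E !inE eqxx.
have: y \in [set z; w] by rewrite -E !inE eqxx orbT.
have: z \in [set x; y] by rewrite E !inE eqxx.
have: w \in [set x; y] by rewrite E !inE eqxx orbT.
rewrite !inE => h1 h2 /orP[]/eqP h3 /orP[]/eqP h4; subst; try by [left|right].
- by move: h1; rewrite orbb => /eqP->; left.
- by move: h2; rewrite orbb => /eqP->; right.
Qed.

(** * Chordless cycles *)

Section Graph.
Variables (N : nat) (e : rel 'I_N).
Hypotheses (esym : ssrbool.symmetric e) (eirr : irreflexive e).

Implicit Types (c p q : seq 'I_N) (x y z u v w : 'I_N).

Lemma cycle_edgesP c x y : uniq c ->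
  reflect ([/\ x \in c, y \in c & y = next c x \/ x = next c y])
          ([set x; y] \in cycle_edges c).
Proof.
move=> uc; apply: (iffP imsetP) => [[z zc E]|[xc yc [->|->]]]; last 2 first.
- by exists x.
- by exists y => //; rewrite setUC.
case: (set2_inj E) => -[-> ->]; rewrite ?mem_next; split=> //; first by left.
by right.
Qed.

Lemma cycle_edges_rot i c : uniq c -> cycle_edges (rot i c) = cycle_edges c.
Proof.
move=> uc; apply/setP=> f; apply/imsetP/imsetP => -[x xc ->]; exists x => //.
- by move: xc; rewrite mem_rot.
- by rewrite next_rot.
- by rewrite mem_rot.
- by rewrite next_rot.
Qed.

Lemma graph_cycle_rot i c : graph_cycle e c -> graph_cycle e (rot i c).
Proof. by case=> uc sc; split; rewrite ?rot_ucycle ?size_rot. Qed.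

Lemma graph_cycle_uniq c : graph_cycle e c -> uniq c.
Proof. by case=> /andP[]. Qed.

Lemma graph_cycle_next c x : graph_cycle e c -> x \in c -> e x (next c x).
Proof. by case=> /andP[cy _] _; apply: next_cycle. Qed.

Lemma graph_cycle_prev c x : graph_cycle e c -> x \in c -> e x (prev c x).
Proof. by case=> /andP[cy _] _ xc; rewrite esym; apply: prev_cycle. Qed.

Lemma cycle_edge_adj c x y :
  graph_cycle e c -> [set x; y] \in cycle_edges c -> e x y.
Proof.
move=> gc /(cycle_edgesP _ _ (graph_cycle_uniq gc)) [xc yc []->].
  exact: graph_cycle_next.
by rewrite esym graph_cycle_next.
Qed.

Lemma chordless_rot i c : uniq c -> chordless e c -> chordless e (rot i c).
Proof.
move=> uc ch x y; rewrite !mem_rot cycle_edges_rot //; exact: ch.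
Qed.

(** Hence a chordless cycle is determined by its set of vertices, which is what
    the enumeration of the chordless cycles below relies on. *)
Lemma chordless_cycle_edges c x y : graph_cycle e c -> chordless e c ->
  ([set x; y] \in cycle_edges c) = [&& x \in c, y \in c & e x y].
Proof.
move=> gc ch; apply/idP/and3P => [h|[xc yc exy]]; last exact: ch.
have [xc yc _] := cycle_edgesP _ _ (graph_cycle_uniq gc) h.
by split=> //; apply: cycle_edge_adj h.
Qed.

Lemma mem_cycle_edges c f : f \in cycle_edges c ->
  exists x y, f = [set x; y].
Proof. by case/imsetP=> x _ ->; exists x, (next c x). Qed.

Lemma chordless_eq_edges c c' : graph_cycle e c -> chordless e c ->
  graph_cycle e c' -> chordless e c' -> c =i c' ->
  cycle_edges c = cycle_edges c'.
Proof.
move=> gc ch gc' ch' E; apply/setP => f.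
apply/idP/idP => h; have [x [y fE]] := mem_cycle_edges h; subst f; move: h.
  by rewrite !chordless_cycle_edges // !E.
by rewrite !chordless_cycle_edges // !E.
Qed.

(** The tool of all inductions from cycles to chordless cycles. The rotation
    puts one end of the chord in front. *)
Lemma chord_split c : graph_cycle e c -> ~ chordless e c ->
  exists i x p1 y p2, [/\ rot i c = x :: p1 ++ y :: p2, e x y,
    graph_cycle e (x :: rcons p1 y), graph_cycle e (y :: rcons p2 x) &
    size (x :: rcons p1 y) < size c /\ size (y :: rcons p2 x) < size c].
Proof.
move=> gc nch; have uc := graph_cycle_uniq gc.
have [x [y [xc yc exy nE]]] : exists x y,
    [/\ x \in c, y \in c, e x y & [set x; y] \notin cycle_edges c].
  apply: contrapT => H; apply: nch => x y xc yc exy.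
  by apply: contrapT => /negP h; apply: H; exists x, y.
have nxy : x != y by apply: contraTneq exy => ->; rewrite eirr.
have [i p1 p2 _ _ cE] := rot_to_arc uc xc yc nxy.
have gc' := graph_cycle_rot i gc; rewrite cE in gc'.
have uc' := graph_cycle_uniq gc'.
have nE' : [set x; y] \notin cycle_edges (x :: p1 ++ y :: p2).
  by rewrite -cE cycle_edges_rot.
have p1n : 0 < size p1.
  case: (p1) uc' nE' => //= uc' /negP[]; apply/cycle_edgesP => //.
  by split; [rewrite !inE eqxx|rewrite !inE eqxx orbT|left; rewrite /= eqxx].
have p2n : 0 < size p2.
  case: (p2) uc' nE' => //; rewrite cats1 => uc' /negP[]; apply/cycle_edgesP => //.
  split; [by rewrite !inE eqxx|by rewrite inE mem_rcons inE eqxx orbT|right].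
  by rewrite next_last.
exists i, x, p1, y, p2; case: gc' => /andP[cy _] _; split=> //.
- split; last by rewrite /= size_rcons ltnS.
  move: cy; rewrite /ucycle /= -cats1 -catA cat_path /= => /and3P[P1 P2 _].
  rewrite !rcons_path last_rcons P1 P2 esym exy.
  by move: uc'; rewrite -cat_cons -cat_rcons cat_uniq rcons_cons => /andP[].
- split; last by rewrite /= size_rcons ltnS.
  move: cy; rewrite /ucycle /= rcons_cat cat_path /= => /and3P[P1 P2 P3].
  rewrite rcons_path P3 last_rcons exy /=.
  move: uc'; rewrite -cat_cons uniq_catC cat_cons -cat_rcons -cat_cons cat_uniq.
  by case/andP.
- have -> : size c = size (x :: p1 ++ y :: p2) by rewrite -cE size_rot.
  by rewrite /= !size_rcons size_cat /= addnS !ltnS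
    -[in X in X <= _]addn1 leq_add2l p2n -add1n leq_add2r p1n.
Qed.

Lemma cycle_edges_split x p1 y p2 f : uniq (x :: p1 ++ y :: p2) ->
  f \in cycle_edges (x :: p1 ++ y :: p2) ->
  f \in cycle_edges (x :: rcons p1 y) \/ f \in cycle_edges (y :: rcons p2 x).
Proof.
move=> us /imsetP[z zc ->].
have {us}us: uniq ((x :: p1) ++ y :: p2) by [].
have us': uniq ((y :: p2) ++ x :: p1) by rewrite uniq_catC.
rewrite -[x :: p1 ++ _]/((x :: p1) ++ y :: p2) in zc *.
move: zc; rewrite mem_cat => /orP[] zp; [left|right]; apply/imsetP; exists z.
- by rewrite -rcons_cons mem_rcons inE zp orbT.
- by rewrite next_rcons.
- by rewrite -rcons_cons mem_rcons inE zp orbT.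
- by rewrite -[RHS]/([set z; next (rcons (y :: p2) x) z]) -(next_rcons us' zp)
    -[in RHS](next_rot (size (y :: p2)) us') rot_size_cat.
Qed.

(** Cut along chords, always keeping a half which contains the edge. *)
Lemma chordless_through c f : graph_cycle e c -> f \in cycle_edges c ->
  exists c', [/\ graph_cycle e c', chordless e c', {subset c' <= c} &
                 f \in cycle_edges c'].
Proof.
have [n] := ubnP (size c); elim: n c => // n IH c sc gc fc.
have [ch|nch] := pselect (chordless e c); first by exists c; split.
have [i [x [p1 [y [p2 [cE exy g1 g2 [s1 s2]]]]]]] := chord_split gc nch.
have uc := graph_cycle_uniq gc.
have sub1 : {subset x :: rcons p1 y <= c}.
  move=> z; rewrite -(mem_rot i c) cE !inE mem_rcons mem_cat !inE.
  by case/or3P=> ->; rewrite ?orbT.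
have sub2 : {subset y :: rcons p2 x <= c}.
  move=> z; rewrite -(mem_rot i c) cE !inE mem_rcons mem_cat !inE.
  by case/or3P=> ->; rewrite ?orbT.
have := fc; rewrite -(cycle_edges_rot i uc) cE => h.
have uc' : uniq (x :: p1 ++ y :: p2) by rewrite -cE rot_uniq.
case: (cycle_edges_split uc' h) => [h1|h2].
- have [|c' [? ? sb ?]] := IH _ _ g1 h1; first exact: leq_trans s1 sc.
  by exists c'; split=> // z /sb/sub1.
- have [|c' [? ? sb ?]] := IH _ _ g2 h2; first exact: leq_trans s2 sc.
  by exists c'; split=> // z /sb/sub2.
Qed.

(** The ends are required to be nonadjacent because the two arcs between them
    then both have inner vertices; the walk may repeat vertices. *)
Definition bridged c := exists u v p,
  [/\ u \in c, v \in c, u != v, ~~ e u v &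
      path e u (rcons p v) /\ {in p, forall z, z \notin c}].

Definition induced (W : pred 'I_N) : rel 'I_N :=
  [rel y z | [&& e y z, W y & W z]].

Lemma induced_sym W : connect_sym (induced W).
Proof.
by apply: sym_connect_sym => y z; rewrite /induced /= esym [W y && _]andbC.
Qed.

Lemma path_induced (W : pred 'I_N) u p :
  path e u p -> {in u :: p, forall z, W z} -> path (induced W) u p.
Proof.
elim: p u => //= z p IH u /andP[euz pz] Wp; apply/andP; split.
  by rewrite /induced /= euz !Wp ?inE ?eqxx ?orbT.
by apply: IH => // t tp; apply: Wp; rewrite inE tp orbT.
Qed.

Lemma connect_walk (W : pred 'I_N) u p z :
  path e u p -> {in u :: p, forall z, W z} -> z \in u :: p ->
  connect (induced W) u z.
Proof. by move=> pp Wp; apply: path_connect; apply: path_induced. Qed.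

Variable A : {set 'I_N}.
Hypothesis eA : forall x y, e x y -> (x \in A) != (y \in A).

Lemma same_side x y z : e x y -> e x z -> ~~ e y z.
Proof.
move=> /eA h1 /eA h2; apply/negP => /eA; move: h1 h2.
by case: (x \in A); case: (y \in A); case: (z \in A).
Qed.

(** * Cycles of a CI graph have no bridge *)

Section Arc.
Hypothesis CI : CI_graph e.
Variable c : seq 'I_N.
Hypotheses (gc : graph_cycle e c) (ch : chordless e c).

(** Let a connected set off the cycle be attached to [a] but not to the next
    vertex [y], and let [b] be the first vertex after [y] to which it is
    attached, if [a] is not the only one. If the arc from [b] back to [a] has an inner vertex, the arc from
    [a] to [b] is closed up by the connected set to a second cycle. The only
    neighbours of [y] in it are the two on the cycle, so a chordless cycle
    inside it through [y] shares two edges with [c]. *)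
Lemma arc_closed x p a :
  path e x p -> {in x :: p, forall z, z \notin c} ->
  a \in c -> has (e a) (x :: p) -> ~~ has (e (next c a)) (x :: p) ->
  forall u v, u \in c -> v \in c -> has (e u) (x :: p) -> has (e v) (x :: p) ->
  u = v \/ e u v.
Proof.
move=> pK Kc ac Na Nxa u v uc vc Nu Nv.
have Uc := graph_cycle_uniq gc.
have [i q cE] := rot_to ac.
have gc' := graph_cycle_rot i gc; rewrite cE in gc'.
have uc' := graph_cycle_uniq gc'.
have ch' := @chordless_rot i c Uc ch; rewrite cE in ch'.
(* [y] is the vertex after [a], to which the set is not attached *)
have [y [t qE]] : exists y t, q = y :: t.
  by case: (q) gc' => [|y t] []; [|exists y, t].
have mc z : (z \in c) = (z \in a :: q) by rewrite -cE mem_rot.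
subst q; rewrite -(next_rot i Uc) cE [next _ _]/= eqxx in Nxa.
have [ht|nt] := boolP (has (fun b => has (e b) (x :: p)) t); last first.
  have K w : w \in c -> has (e w) (x :: p) -> w = a.
    rewrite mc !inE => /or3P[/eqP//|/eqP-> h|wt h]; first by rewrite h in Nxa.
    by case/hasP: nt; exists w.
  by left; rewrite (K u uc Nu) (K v vc Nv).
case: (split_find ht) cE gc' uc' ch' mc => b I t2 Nb NI cE gc' uc' ch' mc.
have [t2E|[w [t3 t2E]]] : t2 = [::] \/ exists w t3, t2 = w :: t3.
  by case: (t2) => [|w t3]; [left|right; exists w, t3].
  subst t2; rewrite cats0 in cE gc' uc' ch' mc.
  have eba : e b a.
    case: gc' => /andP[cy _] _; move: cy; rewrite /= rcons_path last_rcons.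
    by case/and3P.
  have K w : w \in c -> has (e w) (x :: p) -> w = a \/ w = b.
    rewrite mc !inE mem_rcons !inE => /or4P[/eqP|/eqP-> h|/eqP|wt h]; try by [left|right].
    - by rewrite h in Nxa.
    - by case/hasP: NI; exists w.
  case: (K u uc Nu) (K v vc Nv) => -> [] ->; try by left.
  - by right; rewrite esym.
  - by right.
exfalso; subst t2.
(* [w] lies on the arc from [b] back to [a]: it will not be on the new cycle *)
pose W z := z \in a :: rcons I b ++ x :: p.
have yW : ~~ W y.
  rewrite /W inE mem_cat negb_or negb_or; apply/and3P; split.
  - by move: uc' => /= /andP[]; rewrite inE negb_or eq_sym => /andP[].
  - by move: uc' => /= /and3P[_]; rewrite mem_cat negb_or => /andP[].
  - by apply/negP => /Kc; rewrite mc !inE eqxx orbT.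
have path_yIb : path e y (rcons I b ++ w :: t3).
  case: gc' => /andP[cy _] _; move: cy; rewrite /= rcons_path.
  by case/andP => _ /andP[].
have [z [I' IE]] : exists z I', rcons I b = z :: I'.
  by case: (I) => [|z I'] /=; [exists b, [::]|exists z, (rcons I' b)].
have lastI : last z I' = b by rewrite -[last z I']/(last y (z :: I')) -IE last_rcons.
rewrite IE /= cat_path in path_yIb.
case/and3P: path_yIb => eyz pI _.
have con_x k : k \in x :: p -> connect (induced W) x k.
  apply: connect_walk => // l lK; by rewrite /W inE mem_cat lK !orbT.
have WK k : k \in x :: p -> W k by move=> kK; rewrite /W inE mem_cat kK !orbT.
have Wa : W a by rewrite /W inE eqxx.
have Wb : W b by rewrite /W inE mem_cat mem_rcons inE eqxx !orbT.
have con_zb : connect (induced W) z b.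
  apply: (connect_walk pI); last by rewrite -lastI mem_last.
  by move=> l lI; rewrite /W inE mem_cat IE lI orbT.
have con_K l : W l -> has (e l) (x :: p) -> connect (induced W) l x.
  move=> Wl /hasP[k kK elk]; apply: (@connect_trans _ _ k).
    by apply: connect1; rewrite /induced /= elk Wl WK.
  by rewrite induced_sym; apply: con_x.
(* the new cycle: from [y] along the arc to [b], then through the set to [a] *)
have : connect (induced W) z a.
  apply: connect_trans con_zb _; apply: connect_trans (con_K b Wb Nb) _.
  by rewrite induced_sym; apply: con_K.
case/connectP => r0 pr0; case/shortenP: pr0 => r pr ur _ lr.
have pe : path e z r by apply: sub_path pr => ? ? /and3P[].
have rW : {in z :: r, forall l, W l}.
  move=> l; rewrite inE => /orP[/eqP->|].
    by rewrite /W inE mem_cat IE inE eqxx orbT.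
  elim: (r) (z) pr {ur lr pe eyz pI IE lastI con_zb} => //= s rr IH s0 /andP[/and3P[_ _ Ws] pp].
  by rewrite inE => /orP[/eqP-> //|]; apply: IH pp.
have nza : z != a.
  apply/eqP => za; move: uc'; rewrite IE za /= inE.
  by rewrite !inE eqxx /= orbT.
have gD : graph_cycle e (y :: z :: r).
  split; last by case: (r) lr nza => //= ->; rewrite eqxx.
  apply/andP; split; last first.
    by rewrite cons_uniq ur andbT; apply/negP => /rW; rewrite (negPf yW).
  rewrite /= eyz rcons_path pe -lr /=.
  by case: gc' => /andP[/= /andP[]].
have uD := graph_cycle_uniq gD.
have yzD : [set y; z] \in cycle_edges (y :: z :: r).
  by apply/cycle_edgesP => //; rewrite !inE !eqxx orbT; split=> //; left; rewrite /= eqxx.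
have [D [gD' chD subD yzD']] := chordless_through gD yzD.
have uD' := graph_cycle_uniq gD'.
have [yD zD _] := cycle_edgesP _ _ uD' yzD'.
have nbr l : l \in D -> e y l -> l = a \/ l = z.
  move=> lD eyl; have lW : W l.
    move: (subD _ lD); rewrite inE => /orP[/eqP ly|]; last exact: rW.
    by move: eyl; rewrite ly eirr.
  have lK : l \notin x :: p.
    by apply/negP => lK; case/hasP: Nxa; exists l.
  have lc : l \in a :: y :: rcons I b ++ w :: t3.
    move: lW; rewrite /W !inE !mem_cat (negPf lK) orbF.
    by case/orP => ->; rewrite ?orbT.
  have := ch' y l; rewrite !inE eqxx orbT /= -[l \in _]/(l \in _) => /(_ isT).
  rewrite -(in_cons y) -in_cons lc => /(_ isT eyl) /(cycle_edgesP _ _ uc') [_ _].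
  rewrite IE; case=> [->|yn].
    right; rewrite /= eqxx.
    by move: uc'; rewrite /= inE eq_sym; case: eqVneq.
  left; apply: (next_injective uc'); rewrite IE -yn /=.
  by rewrite eqxx.
have aD : a \in D /\ [set y; a] \in cycle_edges D.
  have nn : next D y \in D by rewrite mem_next.
  have pp : prev D y \in D by rewrite mem_prev.
  have := next_neq_prev uD' (proj2 gD') yD.
  case: (nbr _ nn (graph_cycle_next gD' yD)) => nE.
    by move=> _; split; [rewrite -nE|apply/cycle_edgesP => //; split=> //; [rewrite -nE|left]].
  case: (nbr _ pp (graph_cycle_prev gD' yD)) => pE; last by rewrite nE pE eqxx.
  move=> _; split; first by rewrite -pE.
  apply/cycle_edgesP => //; split=> //; first by rewrite -pE.
  by right; rewrite -pE next_prev.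
have wc : w \in c by rewrite mc !inE mem_cat inE eqxx !orbT.
have wD : w \notin D.
  apply/negP => /subD; rewrite inE => /orP[/eqP wy|/rW].
    by case/and3P: uc' => _; rewrite mem_cat inE -wy eqxx orbT.
  rewrite /W inE mem_cat => /or3P[/eqP wa|wI|/Kc]; last by rewrite wc.
    by case/andP: uc'; rewrite inE mem_cat inE wa eqxx !orbT.
  have: uniq (rcons I b ++ w :: t3) by case/and3P: uc'.
  by rewrite cat_uniq => /and3P[_ /hasPn/(_ w)]; rewrite inE eqxx wI => /(_ isT).
have neq : cycle_edges c <> cycle_edges D.
  move=> E; have : [set w; next c w] \in cycle_edges D.
    by rewrite -E; apply: imset_f.
  by case/cycle_edgesP => //; rewrite (negPf wD).
have := CI gc ch gD' chD neq.
apply/negP; rewrite -ltnNge; apply/card_gt1P.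
exists [set y; a], [set y; z]; split.
- rewrite inE (proj2 aD) andbT -(cycle_edges_rot i Uc) cE.
  apply/cycle_edgesP => //; rewrite !inE !eqxx !orbT; split=> //; right.
  by rewrite /= eqxx.
- rewrite inE yzD' andbT -(cycle_edges_rot i Uc) cE IE.
  apply/cycle_edgesP; first by rewrite -IE.
  split; rewrite ?inE ?eqxx ?orbT //; left => /=.
  by rewrite eqxx; move: uc'; rewrite /= inE eq_sym; case: eqVneq.
- apply/eqP => /set2_inj [[_ az]|[yz]]; first by rewrite az eqxx in nza.
  by move=> _; move: eyz; rewrite yz eirr.
Qed.

(** If the vertex [x] added to a walk makes it attached to the whole cycle, then
    the walk was already attached to the vertices on the side of [x], two of
    which are distinct and not adjacent. Otherwise [arc_closed] applies. *)
Lemma attached_step x p :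
  path e x p -> {in x :: p, forall z, z \notin c} ->
  (forall u v, u \in c -> v \in c -> has (e u) p -> has (e v) p ->
     u = v \/ e u v) ->
  forall u v, u \in c -> v \in c -> has (e u) (x :: p) -> has (e v) (x :: p) ->
  u = v \/ e u v.
Proof.
move=> pK Kc IH u v uc vc Nu Nv; have Uc := graph_cycle_uniq gc.
have [allc|nall] := pselect (forall w, w \in c -> has (e w) (x :: p)).
  have [w wc wx] : exists2 w, w \in c & (w \in A) = (x \in A).
    have := eA (graph_cycle_next gc uc).
    have [ux _|ux nx] := eqVneq (u \in A) (x \in A); first by exists u.
    exists (next c u); first by rewrite mem_next.
    by move: ux nx; do 3 case: (_ \in A).
  pose w2 := next c (next c w).
  have nwc : next c w \in c by rewrite mem_next.
  have w2c : w2 \in c by rewrite /w2 !mem_next.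
  have w2x : (w2 \in A) = (x \in A).
    rewrite -wx; have := eA (graph_cycle_next gc wc).
    have := eA (graph_cycle_next gc nwc); rewrite -/w2.
    by do 3 case: (_ \in A).
  have hp t : t \in c -> (t \in A) = (x \in A) -> has (e t) p.
    move=> tc tx; case/orP: (allc t tc) => // /eqP; rewrite eqb_id => /eA.
    by rewrite tx eqxx.
  case: (IH w w2 wc w2c (hp _ wc wx) (hp _ w2c w2x)) => [ww2|/eA].
    have := next_neq_prev Uc (proj2 gc) nwc; rewrite -/w2 -ww2 prev_next //.
    by rewrite eqxx.
  by rewrite wx w2x eqxx.
have [a ac [Na Nxa]] : exists2 a, a \in c &
    has (e a) (x :: p) /\ ~~ has (e (next c a)) (x :: p).
  apply: contrapT => H; apply: nall.
  apply: (next_closed Uc uc Nu) => z zc Nz; apply: contrapT => /negP Nnz.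
  by apply: H; exists z.
exact: (arc_closed pK Kc ac Na Nxa).
Qed.

Lemma CI_attached x p :
  path e x p -> {in x :: p, forall z, z \notin c} ->
  forall u v, u \in c -> v \in c -> has (e u) (x :: p) -> has (e v) (x :: p) ->
  u = v \/ e u v.
Proof.
have Uc := graph_cycle_uniq gc.
elim: p x => [|y p IH] x pK Kc u v uc vc Nu Nv.
  case: (attached_step pK Kc _ uc vc Nu Nv) => //; by [left|right].
apply: (attached_step pK Kc _ uc vc Nu Nv) => {u v uc vc Nu Nv} u v.
apply: IH; first by case/andP: pK.
by move=> z zp; apply: Kc; rewrite inE zp orbT.
Qed.

Lemma CI_not_bridged : ~ bridged c.
Proof.
case=> u [v [[|x p] [uc vc nuv neuv [pp pc]]]].
  by move: pp; rewrite /= andbT (negPf neuv).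
have := pp; rewrite /= => /andP[eux]; rewrite rcons_path => /andP[px elv].
have := CI_attached px pc uc vc; rewrite /= eux => /(_ isT).
have -> : e v x || has (e v) p.
  rewrite -[_ || _]/(has (e v) (x :: p)); apply/hasP; exists (last x p).
    exact: mem_last.
  by rewrite esym.
case=> // [uv|euv]; first by rewrite uv eqxx in nuv.
by rewrite euv in neuv.
Qed.

End Arc.

Lemma chordless_nbr c x z : graph_cycle e c -> chordless e c ->
  x \in c -> z \in c -> e x z -> z = next c x \/ z = prev c x.
Proof.
move=> gc ch xc zc exz; have uc := graph_cycle_uniq gc.
case/(cycle_edgesP _ _ uc): (ch x z xc zc exz) => _ _ [->|->]; first by left.
by right; rewrite prev_next.
Qed.

Lemma last_split (a : pred 'I_N) s : has a s ->
  exists s1 x s2, [/\ s = s1 ++ x :: s2, a x & ~~ has a s2].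
Proof.
elim/last_ind: s => //= s x IH; rewrite has_rcons.
have [ax _|nax /= /IH [s1 [y [s2 [-> ay ns2]]]]] := boolP (a x).
  by exists s, x, [::]; rewrite cats1.
exists s1, y, (rcons s2 x); split=> //; first by rewrite rcons_cat.
by rewrite has_rcons (negPf nax).
Qed.

(** * Chordless cycles which share two edges *)

(** Follow [c2] from a vertex off [c1] in both directions until [c1] is met, in
    [v] and [u]. If these were adjacent, [c2] would close up with the edge
    between them and meet [c1] in this edge only. *)
Lemma shared_edges_bridged c1 c2 :
  graph_cycle e c1 -> chordless e c1 -> graph_cycle e c2 -> chordless e c2 ->
  cycle_edges c1 <> cycle_edges c2 ->
  1 < #|cycle_edges c1 :&: cycle_edges c2| -> bridged c1.
Proof.
move=> g1 ch1 g2 ch2 neq /card_gt1P[f1 [f2 [f1i f2i nf]]].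
have u1 := graph_cycle_uniq g1; have u2 := graph_cycle_uniq g2.
(* inside [c1], the cycle [c2] would follow the edges of [c1] all around *)
have [y yc2 yc1] : exists2 y, y \in c2 & y \notin c1.
  apply: contrapT => H; apply: neq.
  have sub z : z \in c2 -> z \in c1.
    by move=> z2; apply: contrapT => /negP z1; apply: H; exists z.
  apply: chordless_eq_edges => // z; apply/idP/idP; last exact: sub.
  case: (c2) g2 sub => [[]//|h t] g2 sub.
  have u2' := graph_cycle_uniq g2.
  move: z; apply: (next_closed u1 (x := h)); rewrite ?inE ?eqxx //.
    by apply: sub; rewrite inE eqxx.
  move=> z z1 z2.
  have n2 : next (h :: t) z \in h :: t by rewrite mem_next.
  have p2 : prev (h :: t) z \in h :: t by rewrite mem_prev.
  have := next_neq_prev u2' (proj2 g2) z2.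
  have := chordless_nbr g1 ch1 z1 (sub _ n2) (graph_cycle_next g2 z2).
  have := chordless_nbr g1 ch1 z1 (sub _ p2) (graph_cycle_prev g2 z2).
  by case=> [<- //|pE]; case=> [<- //|nE]; rewrite nE pE eqxx.
have [i p cE] := rot_to yc2.
have g2' := graph_cycle_rot i g2; rewrite cE in g2'.
have u2' := graph_cycle_uniq g2'.
have ch2' := @chordless_rot i c2 u2 ch2; rewrite cE in ch2'.
have mc z : (z \in c2) = (z \in y :: p) by rewrite -cE mem_rot.
have mem_p z : z \in c1 -> z \in c2 -> z \in p.
  by move=> z1; rewrite mc inE => /orP[/eqP zy|//]; rewrite zy (negPf yc1) in z1.
have fE f : f \in cycle_edges c1 :&: cycle_edges c2 ->
    exists s t, [/\ f = [set s; t], s != t, s \in c1 /\ s \in p & t \in c1 /\ t \in p].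
  rewrite inE => /andP[h1 h2]; have [s [t fE]] := mem_cycle_edges h1; subst f.
  exists s, t; case/(cycle_edgesP _ _ u2): (h2) => s2 t2 _.
  case/(cycle_edgesP _ _ u1): (h1) => s1 t1 _.
  split=> //; try by split=> //; apply: mem_p.
  by apply: contraTneq (cycle_edge_adj g1 h1) => ->; rewrite eirr.
have hp : has (mem c1) p.
  by have [s [t [_ _ [s1 sp] _]]] := fE _ f1i; apply/hasP; exists s.
case: (split_find hp) mem_p fE cE g2' u2' ch2' mc => v p1 p' v1 n1 mem_p fE cE g2' u2' ch2' mc.
have hp' : has (mem c1) p'.
  have [s [t [_ st [s1 sp] [t1 tp]]]] := fE _ f1i.
  have H z : z \in c1 -> z \in rcons p1 v ++ p' -> z != v -> has (mem c1) p'.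
    move=> z1; rewrite mem_cat mem_rcons inE => /orP[/orP[/eqP->|zp]|zp] nzv.
    - by rewrite eqxx in nzv.
    - by case/hasP: n1; exists z.
    - by apply/hasP; exists z.
  have [sv|] := eqVneq s v; last exact: H.
  by apply: (H t) => //; rewrite -sv eq_sym.
have [p2 [u [p3 [pE uc1 n3]]]] := last_split hp'; subst p'.
have cyL : path e y (rcons p1 v ++ (p2 ++ u :: rcons p3 y)).
  by case: g2' => /andP[cy _] _; move: cy; rewrite /= !rcons_cat rcons_cons.
rewrite cat_path last_rcons cat_path /= in cyL.
case/and4P: cyL => path_yv path_vp2 elu path_uy.
have uin : uniq (rcons p1 v ++ p2 ++ u :: p3) by case/andP: u2'.
have nuv : u != v.
  move: uin; rewrite cat_uniq => /and3P[_ /hasPn/(_ u)].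
  rewrite mem_cat inE eqxx orbT => /(_ isT) + _.
  by rewrite /= mem_rcons inE negb_or => /andP[].
exists u, v, (p3 ++ y :: p1); split=> //; last first.
  split; first by rewrite -cat_rcons rcons_cat cat_path path_uy last_rcons.
  move=> z; rewrite mem_cat inE => /or3P[h|/eqP->//|h]; apply/negP => z1.
    by case/hasP: n3; exists z.
  by case/hasP: n1; exists z.
apply/negP => euv.
have uL : u \in y :: rcons p1 v ++ p2 ++ u :: p3.
  by rewrite inE !mem_cat inE eqxx !orbT.
have vL : v \in y :: rcons p1 v ++ p2 ++ u :: p3.
  by rewrite inE !mem_cat mem_rcons inE eqxx !orbT.
case/(cycle_edgesP _ _ u2'): (ch2' u v uL vL euv) => _ _.
case=> [vn|un].
  case: p3 {hp' mc ch2' g2' cE fE mem_p path_uy uL vL uin} n3 vn u2' => [_|z p3 n3].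
    rewrite cats1 -!rcons_cat => vn u2'; rewrite next_last // in vn.
    by move: v1; rewrite /= vn (negPf yc1).
  rewrite catA -cat_cons => vn u2'; rewrite next_cat // in vn.
  by case/hasP: n3; exists v => //; rewrite vn inE eqxx.
case: p2 un u2' uin fE {hp' mc ch2' g2' cE mem_p path_vp2 elu uL vL} => [_ _ _|z p2]; last first.
  rewrite cat_rcons -cat_cons => un u2' uin _; rewrite next_cat // in un.
  rewrite -cat_rcons in uin.
  have {}uin : uniq (rcons p1 v ++ u :: p2 ++ u :: p3) by rewrite {1}un.
  move: uin; rewrite cat_uniq => /and3P[_ _] /andP[].
  by rewrite mem_cat inE eqxx orbT.
rewrite cat0s => fE.
have K z : z \in c1 -> z \in rcons p1 v ++ u :: p3 -> z = u \/ z = v.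
  move=> z1; rewrite mem_cat mem_rcons !inE => /orP[/orP[/eqP->|h]|/orP[/eqP->|h]].
  - by right.
  - by case/hasP: n1; exists z.
  - by left.
  - by case/hasP: n3; exists z.
have fuv f : f \in cycle_edges c1 :&: cycle_edges c2 -> f = [set u; v].
  case/fE=> s [t [-> nst [s1 sp] [t1 tp]]].
  case: (K s s1 sp) nst => ->; case: (K t t1 tp) => -> //; rewrite ?eqxx //.
  by rewrite setUC.
by rewrite (fuv f1) // (fuv f2) // eqxx in nf.
Qed.

(** * The two sides of a cycle without bridge *)

Section Side.
Variables (c : seq 'I_N) (a : 'I_N).
Hypotheses (gc : graph_cycle e c) (ch : chordless e c) (ac : a \in c).
Hypothesis nb : ~ bridged c.

(** What can be reached from the successor of [a] without meeting the cycle
    again. The neighbours of [a] in it are its successor and those which belong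
    to a piece attached to the edge between the two. *)
Definition side : pred 'I_N :=
  connect (induced [pred z | (z \notin c) || (z == next c a)]) (next c a).

Lemma side_next : side (next c a). Proof. exact: connect0. Qed.

Lemma connect_inducedP (W : pred 'I_N) x y : connect (induced W) x y -> y = x \/ W y.
Proof.
case/connectP => p pp ->; case/lastP: p pp => [|p z]; first by left.
by rewrite rcons_path last_rcons => /andP[_ /and3P[_ _ Wz]]; right.
Qed.

Lemma side_cycle z : side z -> z \in c -> z = next c a.
Proof. by case/connect_inducedP => //= /orP[/negPf->|/eqP]. Qed.

Lemma side_prev : ~~ side (prev c a).
Proof.
apply/negP => /side_cycle; rewrite mem_prev => /(_ ac) E.
by have := next_neq_prev (graph_cycle_uniq gc) (proj2 gc) ac; rewrite E eqxx.
Qed.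

Lemma side_off y p : path e y p -> {in y :: p, forall z, z \notin c} ->
  side y = side (last y p).
Proof.
move=> pp off; apply: same_connect_r; first exact: induced_sym.
apply: (connect_walk pp); last exact: mem_last.
by move=> z /off /= ->.
Qed.

(** A walk leaving the cycle at [a] either never comes back to it or, as there
    is no bridge, comes back at a neighbour of [a], where it ends. If this
    neighbour is the predecessor of [a] the walk did not begin on the side of
    the successor, since it would then be part of a bridge between the two. *)
Lemma side_walk y t : path e a (y :: t) -> uniq (a :: y :: t) ->
  {in y :: t, forall z, e a z -> z = y \/ z = last y t} ->
  y \notin c -> side y = side (last y t).
Proof.
move=> pt ut nbr yc; have uc := graph_cycle_uniq gc.
have [ht|nt] := boolP (has (mem c) t); last first.
  apply: side_off; first by case/andP: pt.
  move=> z; rewrite inE => /orP[/eqP->//|zt]; apply/negP => zc.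
  by case/hasP: nt; exists z.
case: (split_find ht) pt ut nbr => w s1 s2 wc n1 pt ut nbr.
have off : {in y :: s1, forall z, z \notin c}.
  move=> z; rewrite inE => /orP[/eqP->//|zt]; apply/negP => zc.
  by case/hasP: n1; exists z.
have [eay pys1 esw] : [/\ e a y, path e y s1 & e (last y s1) w].
  move: pt; rewrite /= cat_path rcons_path => /andP[-> /andP[/andP[-> ->]]] //.
have naw : a != w.
  apply: contraTneq ut => ->.
  by rewrite cons_uniq inE mem_cat mem_rcons inE eqxx !orbT.
have eaw : e a w.
  apply: contrapT => /negP neaw; apply: nb; exists a, w, (y :: s1); split=> //.
  by split=> //; rewrite rcons_cons /= eay rcons_path pys1.
have nyw : w != y.
  apply: contraTneq ut => ->.
  by rewrite 2!cons_uniq mem_cat mem_rcons inE eqxx /= andbF.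
have wl : w = last y (rcons s1 w ++ s2).
  case: (nbr w _ eaw) => //; last by move=> wy; rewrite wy eqxx in nyw.
  by rewrite inE mem_cat mem_rcons inE eqxx !orbT.
rewrite -wl; case: (chordless_nbr gc ch ac wc eaw) => wE.
  rewrite wE side_next -[side y]/(connect _ _ _) induced_sym.
  apply: (@connect_trans _ _ (last y s1)).
    apply: (connect_walk pys1); last exact: mem_last.
    by move=> z /off /= ->.
  apply: connect1; rewrite /induced /= -wE esw eqxx orbT andbT.
  by rewrite off // mem_last.
rewrite wE (negPf side_prev); apply/negP => /connectP[r0 pr0].
case/shortenP: pr0 => r pr ur _ yl.
apply: nb; exists (next c a), (prev c a), (r ++ s1); split.
- by rewrite mem_next.
- by rewrite mem_prev.
- by apply: next_neq_prev => //; case: gc.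
- by apply: (same_side (x := a)); [apply: graph_cycle_next|apply: graph_cycle_prev].
split.
  rewrite rcons_cat cat_path -yl rcons_path pys1 -wE esw !andbT.
  by apply: sub_path pr => ? ? /and3P[].
move=> z; rewrite mem_cat => /orP[zr|zs1]; last by apply: off; rewrite inE zs1 orbT.
have: z != next c a by apply: contraTneq zr => ->; case/andP: ur.
have: connect (induced [pred z | (z \notin c) || (z == next c a)]) (next c a) z.
  by apply: (path_connect pr); rewrite inE zr orbT.
by case/connect_inducedP=> [->|/orP[//|->//]]; rewrite eqxx.
Qed.

(** This makes the linear form of [flow_diff] below vanish on [c']: its two edges
    at [a] lead to the same side. *)
Lemma side_chordless c' : graph_cycle e c' -> chordless e c' ->
  cycle_edges c <> cycle_edges c' ->
  #|cycle_edges c :&: cycle_edges c'| <= 1 -> a \in c' ->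
  side (next c' a) = side (prev c' a).
Proof.
move=> gc' ch' neq le1 ac'; have uc' := graph_cycle_uniq gc'.
have uc := graph_cycle_uniq gc.
have nc' : next c' a \in c' by rewrite mem_next.
have pc' : prev c' a \in c' by rewrite mem_prev.
have eqn : [set a; next c' a] != [set a; prev c' a].
  have := next_neq_prev uc' (proj2 gc') ac'; apply: contraNneq.
  by case/set2_inj => [[_ ->]|[{1}<- ->]].
have [i q cE] := rot_to ac'.
have g2 := graph_cycle_rot i gc'; rewrite cE in g2.
have [y [t qE]] : exists y t, q = y :: t.
  by case: (q) g2 => [|y t] []; [|exists y, t].
subst q; have u2 := graph_cycle_uniq g2.
have nE : next c' a = y by rewrite -(next_rot i uc') cE /= eqxx.
have pE : prev c' a = last y t.
  rewrite -(prev_rot i uc') cE; apply: (next_injective u2); rewrite next_prev //.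
  by move: u2; rewrite (lastI y t) => u2; rewrite next_last.
have nbr : {in y :: t, forall z, e a z -> z = y \/ z = last y t}.
  move=> z zt eaz; rewrite -pE -nE; apply: chordless_nbr => //.
  by rewrite -(mem_rot i) cE inE zt orbT.
have pt : path e a (y :: t).
  by case: g2 => /andP[/= /andP[-> cy] _] _; move: cy; rewrite rcons_path => /andP[].
have [yc|yc] := boolP (y \in c); last by rewrite nE pE; apply: side_walk.
have [lc|lc] := boolP (last y t \in c).
  have := le1; rewrite leqNgt => /negP[]; apply/card_gt1P.
  exists [set a; next c' a], [set a; prev c' a]; rewrite eqn !inE nE pE; split=> //.
    apply/andP; split; first by apply: ch => //; rewrite -nE; apply: graph_cycle_next.
    by rewrite -nE; apply: ch' => //; apply: graph_cycle_next.
  apply/andP; split; first by apply: ch => //; rewrite -pE; apply: graph_cycle_prev.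
  by rewrite -pE; apply: ch' => //; apply: graph_cycle_prev.
have rp : path e a (rcons (rev (y :: t)) a).
  have: path e a (rcons (y :: t) a) by case: g2 => /andP[].
  rewrite -rev_path last_rcons belast_rcons rev_cons.
  by congr is_true; apply: eq_path => ? ?; rewrite esym.
have [z [s sE]] : exists z s, rev (y :: t) = z :: s.
  by rewrite rev_cons; case: (rev t) => [|z s]; [exists y, [::]|exists z, (rcons s y)].
have zE : z = last y t by move: sE; rewrite lastI rev_rcons => -[<-].
have yE : y = last z s.
  by rewrite -[RHS]/(last a (z :: s)) -sE -[y :: t]/([:: y] ++ t) rev_cat last_cat.
rewrite sE rcons_path in rp; case/andP: rp => rp _.
rewrite nE pE -zE yE; symmetry; apply: side_walk => //.
- by rewrite -sE; move: u2; rewrite !(cons_uniq a) rev_uniq mem_rev.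
- rewrite -sE => w; rewrite mem_rev => /nbr H /H; rewrite -yE zE.
  by case; [right|left].
- by rewrite zE.
Qed.
End Side.

End Graph.

(** * Degrees and matchings *)

Section Exponents.
Variables (N : nat) (e : rel 'I_N) (A : {set 'I_N}).
Hypotheses (esym : ssrbool.symmetric e) (eirr : irreflexive e).
Hypothesis eA : forall x y, e x y -> (x \in A) != (y \in A).

Local Notation M := #|edges e|.
Implicit Types (c p q : seq 'I_N) (x y z : 'I_N) (u v w m : 'X_{1..M}) (i : 'I_M).

Definition edge_exp x y : 'X_{1..M} :=
  [multinom (enum_val i == [set x; y] : nat) | i < M].

(** The edge algebra sends the monomial of exponent [m] to the monomial of
    exponent [deg m]. *)
Definition deg m : 'X_{1..N} :=
  [multinom (\sum_(i < M | x \in enum_val i) m i)%N | x < N].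

Lemma edgeP i : exists x y, e x y /\ enum_val i = [set x; y].
Proof.
have /imset2P[x y _] := enum_valP i; rewrite inE => exy ->.
by exists x, y.
Qed.

Lemma edge_in x y : e x y -> [set x; y] \in edges e.
Proof. by move=> exy; apply/imset2P; exists x y => //; rewrite inE. Qed.

Lemma edge_index x y : e x y -> exists i, enum_val i = [set x; y].
Proof.
move=> /edge_in h; exists (enum_rank_in h [set x; y]).
by rewrite enum_rankK_in.
Qed.

Lemma edge_expC x y : edge_exp x y = edge_exp y x.
Proof. by apply/mnmP => i; rewrite !mnmE setUC. Qed.

Lemma edge_expE i x y : enum_val i = [set x; y] -> edge_exp x y = U_(i)%MM.
Proof.
move=> iE; apply/mnmP => j; rewrite mnmE mnm1E -iE.
by rewrite (inj_eq enum_val_inj) eq_sym.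
Qed.

Lemma degD m1 m2 : deg (m1 + m2)%MM = (deg m1 + deg m2)%MM.
Proof.
apply/mnmP=> x; rewrite mnmDE !mnmE -big_split /=.
by apply: eq_bigr => i _; rewrite mnmDE.
Qed.

Lemma deg0 : deg 0%MM = 0%MM.
Proof. by apply/mnmP=> x; rewrite !mnmE big1 // => i _; rewrite mnmE. Qed.

Lemma deg_sum (I : Type) (r : seq I) (P : pred I) (F : I -> 'X_{1..M}) :
  deg (\sum_(i <- r | P i) F i)%MM = (\sum_(i <- r | P i) deg (F i))%MM.
Proof. exact: (big_morph _ degD deg0). Qed.

Lemma deg_edge_exp x y : e x y -> deg (edge_exp x y) = (U_(x) + U_(y))%MM.
Proof.
move=> exy; have [i iE] := edge_index exy; rewrite (edge_expE iE).
apply/mnmP => z; rewrite mnmDE !mnm1E mnmE.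
transitivity (z \in enum_val i : nat).
  have [zi|zi] := boolP (z \in enum_val i).
    by rewrite (bigD1 i) //= mnm1E eqxx big1 // => j /andP[_ /negPf ji];
      rewrite mnm1E eq_sym ji.
  rewrite big1 // => j zj; rewrite mnm1E; case: eqVneq => // ij.
  by rewrite ij zj in zi.
rewrite iE !inE ![z == _]eq_sym; case: eqVneq => [<-|//].
by case: eqVneq => // yx; rewrite yx eirr in exy.
Qed.

Lemma deg_gt0 m i x : 0 < m i -> x \in enum_val i -> 0 < deg m x.
Proof. by move=> mi xi; rewrite mnmE (bigD1 i) //= addn_gt0 mi. Qed.

Lemma deg_gt0P m x : 0 < deg m x -> exists i y,
  [/\ 0 < m i, enum_val i = [set x; y] & e x y].
Proof.
rewrite mnmE lt0n sum_nat_eq0 negb_forall => /existsP[i].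
rewrite negb_imply => /andP[xi]; rewrite -lt0n => mi.
have [y [z [eyz iE]]] := edgeP i; move: xi; rewrite iE !inE => /orP[]/eqP->.
  by exists i, z.
by exists i, y; rewrite esym; split=> //; rewrite iE setUC.
Qed.

Lemma deg_eq0 m : deg m = 0%MM -> m = 0%MM.
Proof.
move=> d0; apply/mnmP => i; rewrite mnmE; apply/eqP.
rewrite -leqn0 leqNgt; apply/negP => mi; have [x [y [_ iE]]] := edgeP i.
by have := deg_gt0 mi (x := x); rewrite d0 mnmE iE !inE eqxx; move/(_ isT).
Qed.

(** Every second edge of a walk: those leaving from the vertices on the side [b]
    of the bipartition. *)
Fixpoint walk_exp (b : bool) x p : 'X_{1..M} :=
  if p is y :: p' then
    ((if (x \in A) == b then edge_exp x y else 0) + walk_exp b y p')%MM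
  else 0%MM.

(** The two perfect matchings of a cycle are [cycle_exp true c] and
    [cycle_exp false c]. *)
Definition cycle_exp b c := if c is x :: p then walk_exp b x (rcons p x) else 0%MM.

Lemma walk_exp_cat b x p q :
  walk_exp b x (p ++ q) = (walk_exp b x p + walk_exp b (last x p) q)%MM.
Proof.
elim: p x => [|y p IH] x /=; first by rewrite add0m.
by rewrite IH addmA.
Qed.

Lemma walk_exp_rcons b x p y :
  walk_exp b x (rcons p y) = (walk_exp b x p +
    (if (last x p \in A) == b then edge_exp (last x p) y else 0))%MM.
Proof. by rewrite -cats1 walk_exp_cat /= addm0. Qed.

Lemma cycle_exp_cat b x p y q :
  cycle_exp b (x :: p ++ y :: q) = (walk_exp b x (rcons p y) + walk_exp b y (rcons q x))%MM.
Proof. by rewrite /cycle_exp rcons_cat rcons_cons -cat_rcons walk_exp_cat last_rcons. Qed.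

Lemma cycle_exp_rot b (n : nat) c : cycle_exp b (rot n c) = cycle_exp b c.
Proof.
rewrite /rot -[in RHS](cat_take_drop n c).
case: (take n c) (drop n c) => [|x p] s; first by rewrite cats0.
case: s => [|y q]; first by rewrite cats0.
by rewrite !cat_cons !cycle_exp_cat addmC.
Qed.

Lemma cycle_exp_sum b c : uniq c ->
  cycle_exp b c = (\sum_(x <- c | (x \in A) == b) edge_exp x (next c x))%MM.
Proof.
case: c => [|x p] up; first by rewrite big_nil.
have := cycle_next up; rewrite /cycle /cycle_exp.
move: (next (x :: p)) => f; rewrite -(belast_rcons x p x).
move: (rcons p x) => s; elim: s x {up} => [|y s IH] x /=.
  by rewrite big_nil.
case/andP=> /eqP <- /IH ->; rewrite big_cons.
by case: ifP => // _; rewrite add0m.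
Qed.

Definition vertices_exp c : 'X_{1..N} := [multinom (x \in c : nat) | x < N].

Lemma sum_mnm1 c (P : pred 'I_N) x : uniq c ->
  (\sum_(y <- c | P y) U_(y))%MM x = ((x \in c) && P x : nat).
Proof.
move=> uc; rewrite mnm_sumE; case: (boolP (x \in c)) => [xc|xc] /=.
  rewrite big_mkcond (bigD1_seq x) //= mnm1E eqxx big1_seq ?addn0 => [|y /andP[yx _]].
    by case: ifP.
  by rewrite mnm1E (negPf yx); case: ifP.
rewrite big1_seq // => y /andP[_ yc]; rewrite mnm1E; case: eqVneq => // yx.
by rewrite -yx yc in xc.
Qed.

Lemma perm_next (T : eqType) (c : seq T) : uniq c -> perm_eq (map (next c) c) c.
Proof.
move=> uc; apply: uniq_perm => //; first by rewrite (map_inj_uniq (next_injective uc)).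
move=> x; apply/mapP/idP => [[y yc ->]|xc]; first by rewrite mem_next.
by exists (prev c x); rewrite ?mem_prev ?next_prev.
Qed.

Lemma deg_cycle_exp b c : graph_cycle e c -> deg (cycle_exp b c) = vertices_exp c.
Proof.
move=> gc; have uc := graph_cycle_uniq gc.
rewrite cycle_exp_sum // deg_sum.
have -> : (\sum_(x <- c | (x \in A) == b) deg (edge_exp x (next c x)) =
          \sum_(x <- c | (x \in A) == b) (U_(x) + U_(next c x)))%MM.
  rewrite big_seq_cond [in RHS]big_seq_cond; apply: eq_bigr => x /andP[xc _].
  by rewrite deg_edge_exp // graph_cycle_next.
rewrite big_split /=.
have -> : (\sum_(x <- c | (x \in A) == b) U_(next c x) =
          \sum_(x <- c | (x \in A) != b) U_(x))%MM.
  rewrite -[in RHS](perm_big _ (perm_next uc)) big_map /= big_seq_cond [in RHS]big_seq_cond.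
  apply: eq_bigl => x; case xc: (x \in c) => //=.
  by have := eA (graph_cycle_next gc xc); case: b; do 2 case: (_ \in A).
apply/mnmP => x; rewrite mnmDE !sum_mnm1 // mnmE.
by case: (x \in c); case: (_ == b).
Qed.

Lemma cycle_expE b c i : graph_cycle e c ->
  cycle_exp b c i =
  (has (fun x => ((x \in A) == b) && (enum_val i == [set x; next c x])) c : nat).
Proof.
move=> gc; have uc := graph_cycle_uniq gc; rewrite cycle_exp_sum // mnm_sumE.
have [/hasP[x xc /andP[xb /eqP iE]]|/hasPn nh] := boolP (has _ _); last first.
  rewrite big1_seq // => x /andP[xb xc]; rewrite mnmE.
  by have := nh x xc; rewrite xb /= => /negPf->.
rewrite big_mkcond (bigD1_seq x) //= xb mnmE iE eqxx big1_seq // => y /andP[yx yc].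
case: ifP => // yb; rewrite mnmE; case: eqVneq => // E; exfalso.
have xy : (x \in A) = (y \in A) by rewrite (eqP xb) (eqP yb).
move: E; rewrite iE => /set2_inj[[xy' _]|[_ yE]].
  by rewrite xy' eqxx in yx.
by have := eA (graph_cycle_next gc xc); rewrite yE xy eqxx.
Qed.

Lemma cycle_exp_gt0P b c i : graph_cycle e c -> 0 < cycle_exp b c i ->
  exists x, [/\ x \in c, (x \in A) = b & enum_val i = [set x; next c x]].
Proof.
move=> gc; rewrite cycle_expE // lt0b => /hasP[x xc /andP[/eqP xb /eqP iE]].
by exists x.
Qed.

Lemma cycle_exp_disj c i : graph_cycle e c ->
  0 < cycle_exp true c i -> 0 < cycle_exp false c i -> False.
Proof.
move=> gc /(cycle_exp_gt0P gc)[x [xc xA iE]] /(cycle_exp_gt0P gc)[y [yc yA]].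
have uc := graph_cycle_uniq gc.
rewrite iE => /set2_inj[[xy _]|[xy yx]]; first by rewrite xy yA in xA.
have := next_neq_prev uc (proj2 gc) xc.
by rewrite {2}xy prev_next // yx eqxx.
Qed.

Lemma cycle_exp_le b c m : graph_cycle e c ->
  (forall x i, x \in c -> (x \in A) = b -> enum_val i = [set x; next c x] -> 0 < m i) ->
  (cycle_exp b c <= m)%MM.
Proof.
move=> gc H; apply/mnm_lepP => i; have [->//|h] := posnP (cycle_exp b c i).
have [x [xc xb iE]] := cycle_exp_gt0P gc h.
by apply: leq_trans _ (H x i xc xb iE); rewrite cycle_expE // leq_b1.
Qed.

(** At an inner vertex a walk uses one edge of each class; only its ends make a
    difference. *)
Lemma deg_walk_exp x p : path e x p ->
  (deg (walk_exp true x p) + (if last x p \in A then U_(last x p) else 0)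
    + (if x \notin A then U_(x) else 0) =
  deg (walk_exp false x p) + (if last x p \notin A then U_(last x p) else 0)
    + (if x \in A then U_(x) else 0))%MM.
Proof.
elim: p x => [|y p IH] x /=; first by rewrite deg0; case: (x \in A); rewrite ?add0m ?addm0.
case/andP=> exy /IH {IH}; rewrite !degD; have := eA exy.
set d1 := deg _; set d2 := deg _ ; set l := last y p.
have dx : deg (edge_exp x y) = (U_(x) + U_(y))%MM by rewrite deg_edge_exp.
case: (x \in A); case: (y \in A) => //= _; rewrite dx deg0 => /mnmP H;
  apply/mnmP => z; move: (H z); rewrite !mnmDE ?mnm0E; lia.
Qed.

(** Leave each vertex of [A] along an edge of [u] and each other vertex along an
    edge of [v]. This map on the vertices has a periodic point, and its orbit is
    a cycle whose edges alternate between [u] and [v]. *)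
Lemma alternating_cycle u v : deg u = deg v -> u != 0%MM ->
  (forall i, 0 < u i -> v i = 0) ->
  exists c, [/\ graph_cycle e c, (cycle_exp true c <= u)%MM & (cycle_exp false c <= v)%MM].
Proof.
move=> duv u0 disj.
pose w x := if x \in A then u else v.
pose out x y := e x y /\ exists2 i, 0 < w x i & enum_val i = [set x; y].
have outP x : 0 < deg u x -> exists y, out x y.
  move=> dx; have : 0 < deg (w x) x by rewrite /w; case: ifP; rewrite -?duv.
  by case/deg_gt0P=> i [y [wi iE exy]]; exists y; split=> //; exists i.
pose f x := if pselect (exists y, out x y) is left h then projT1 (cid h) else x.
have fP x : 0 < deg u x -> out x (f x).
  move=> /outP h; rewrite /f; case: pselect => // h'; exact: (projT2 (cid h')).
have f_deg x : 0 < deg u x -> 0 < deg u (f x).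
  move=> /fP [_ [i wi iE]].
  have : 0 < deg (w x) (f x) by apply: (deg_gt0 wi); rewrite iE !inE eqxx orbT.
  by rewrite /w; case: ifP; rewrite -?duv.
have [x0 x0d] : exists x, 0 < deg u x.
  apply: contrapT => H; move: u0; rewrite (deg_eq0 (m := u)) ?eqxx //.
  apply/mnmP => x; rewrite [RHS]mnmE; apply/eqP; rewrite -leqn0 leqNgt.
  by apply/negP => h; apply: H; exists x.
have iter_deg n : 0 < deg u (iter n f x0) by elim: n => //= n; apply: f_deg.
have [x [xd [k xk]]] : exists x, 0 < deg u x /\ exists k, iter k.+1 f x = x.
  have : ~~ injectiveb (fun n : 'I_N.+1 => iter n f x0).
    apply/negP => /injectiveP /leq_card; rewrite !card_ord ltnn //.
  case/injectivePn=> i [j nij E]; wlog lij : i j nij E / i < j.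
    move=> H; case: (ltngtP i j) => [h|h|/val_inj h]; last by rewrite h eqxx in nij.
      exact: H h.
    by apply: H h; rewrite // eq_sym.
  exists (iter i f x0); split=> //; exists (j - i).-1.
  by rewrite prednK ?subn_gt0 // -iterD subnK // ltnW.
have fc : fcycle f (orbit f x) by apply/(orbitPcycle 0 3); exists k.
have uo : uniq (orbit f x) by exact: orbit_uniq.
have next_o y : y \in orbit f x -> next (orbit f x) y = f y by apply: nextE.
have od y : y \in orbit f x -> 0 < deg u y.
  by rewrite -fconnect_orbit => /iter_findex <-; elim: (findex _ _ _) => //= n; apply: f_deg.
have fA y : 0 < deg u y -> (y \in A) != (f y \in A) by move=> /fP[/eA].
have ff y : 0 < deg u y -> f (f y) != y.
  move=> yd; apply/eqP => ffy; have [_ [i wi iE]] := fP _ yd.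
  have [_ [j wj]] := fP _ (f_deg _ yd); rewrite ffy setUC -iE => /enum_val_inj ji.
  subst j; have := fA _ yd; move: wi wj; rewrite /w.
  case: (y \in A); case: (f y \in A) => //= h1 h2 _.
    by rewrite (disj i h1) in h2.
  by rewrite (disj i h2) in h1.
have go : graph_cycle e (orbit f x).
  split.
    apply/andP; split=> //; apply: cycle_from_next => // y yo.
    by rewrite next_o //; case: (fP _ (od _ yo)).
  have xo : x \in orbit f x by rewrite -fconnect_orbit connect0.
  have neq y : 0 < deg u y -> f y != y.
    by move=> /fA; apply: contraNneq => ->.
  apply: (@uniq_leq_size _ [:: x; f x; f (f x)]).
    rewrite /= !inE negb_or ![x == _]eq_sym ff // eq_sym.
    by rewrite [x == _]eq_sym neq // eq_sym neq // f_deg.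
  move=> y; rewrite !inE => /or3P[]/eqP->//; rewrite -!next_o ?mem_next //.
exists (orbit f x); split=> //; apply: cycle_exp_le => // y i yo yA; rewrite next_o // => iE.
  have [_ [j]] := fP _ (od _ yo); rewrite -iE /w yA => h /enum_val_inj <- //.
have [_ [j]] := fP _ (od _ yo); rewrite -iE /w yA => h /enum_val_inj <- //.
Qed.

(** * Connectedness of the fibers *)

(** The same argument is used for membership in an ideal and for membership in
    a space of rational vectors, hence an arbitrary relation [R]. The set [W]
    keeps track of the vertices of the cycles in use. *)
Section Congruence.
Variables (W : pred 'I_N) (R : 'X_{1..M} -> 'X_{1..M} -> Prop).
Hypothesis Rrefl : forall u, R u u.
Hypothesis Rtrans : forall u v w, R u v -> R v w -> R u w.
Hypothesis RD : forall w u v, R u v -> R (u + w)%MM (v + w)%MM.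
Hypothesis Rch : forall c, graph_cycle e c -> chordless e c ->
  {in c, forall z, W z} -> R (cycle_exp true c) (cycle_exp false c).

(** With a chord between its ends, each of the two arcs becomes a cycle. The
    intermediate monomial contains the chord: exchange the matchings of one half
    and then those of the other. *)
Lemma cycle_congruence c : graph_cycle e c -> {in c, forall z, W z} ->
  R (cycle_exp true c) (cycle_exp false c).
Proof.
have [n] := ubnP (size c); elim: n c => // n IH c sc gc Wc.
have [ch|nch] := pselect (chordless e c); first exact: Rch.
have [i [x [p1 [y [p2 [cE exy g1 g2 [s1 s2]]]]]]] := chord_split esym eirr gc nch.
have W1 : {in x :: rcons p1 y, forall z, W z}.
  move=> z zp; apply: Wc; rewrite -(mem_rot i c) cE; move: zp.
  by rewrite !inE mem_rcons mem_cat !inE; case/or3P=> ->; rewrite ?orbT.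
have W2 : {in y :: rcons p2 x, forall z, W z}.
  move=> z zp; apply: Wc; rewrite -(mem_rot i c) cE; move: zp.
  by rewrite !inE mem_rcons mem_cat !inE; case/or3P=> ->; rewrite ?orbT.
have R1 := IH _ (leq_trans s1 sc) g1 W1.
have R2 := IH _ (leq_trans s2 sc) g2 W2.
rewrite -(cycle_exp_rot true i) -(cycle_exp_rot false i) cE !cycle_exp_cat.
move: R1 R2; rewrite /cycle_exp (walk_exp_rcons true x) (walk_exp_rcons false x).
rewrite (walk_exp_rcons true y) (walk_exp_rcons false y) !last_rcons (edge_expC y x).
set U1 := walk_exp true x _; set V1 := walk_exp false x _.
set U2 := walk_exp true y _; set V2 := walk_exp false y _.
have := eA exy; case: (x \in A); case: (y \in A) => //= _; rewrite !addm0 => R1 R2.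
  apply: Rtrans (RD U2 R1) _; rewrite -addmA [(edge_exp x y + U2)%MM]addmC.
  by rewrite addmC [(V1 + V2)%MM]addmC; apply: RD.
rewrite addmC; apply: Rtrans (RD U1 R2) _.
by rewrite addmC [(V2 + edge_exp x y)%MM]addmC addmA; apply: RD.
Qed.

(** By induction on the degree: divide by a common edge, or exchange the two
    matchings of an alternating cycle and cancel them. *)
Theorem fiber_connected u v : deg u = deg v -> (forall x, 0 < deg u x -> W x) ->
  R u v.
Proof.
have [n] := ubnP (mdeg u); elim: n u v => // n IH u v mu duv Wu.
have [u0|u0] := eqVneq u 0%MM.
  by rewrite (deg_eq0 (m := v)) -?duv u0 ?deg0.
have [[i ui vi]|nsh] := pselect (exists2 i, 0 < u i & 0 < v i).
  have Ui m : 0 < m i -> m = (m - U_(i) + U_(i))%MM.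
    by move=> mi; rewrite submK // lep1mP -lt0n.
  rewrite (Ui u ui) (Ui v vi); apply: RD.
  have mE : mdeg u = (mdeg (u - U_(i))).+1.
    by rewrite [in LHS](Ui u ui) mdegD mdeg1 addn1.
  apply: IH.
  - by rewrite mE ltnS in mu.
  - apply: (@addIm _ (deg U_(i)%MM)); rewrite -!degD -!Ui //.
  - move=> x h; apply: Wu; rewrite (Ui u ui) degD mnmDE addn_gt0 h //.
have [|c [gc cu cv]] := alternating_cycle duv u0.
  move=> i ui; apply/eqP; rewrite -leqn0 leqNgt; apply/negP => vi.
  by apply: nsh; exists i.
have Wc : {in c, forall z, W z}.
  move=> z zc; apply: Wu; rewrite -(submK cu) degD mnmDE (deg_cycle_exp true gc).
  by rewrite [vertices_exp c z]mnmE zc addn1.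
have dc : deg (cycle_exp true c) = deg (cycle_exp false c) by rewrite !deg_cycle_exp.
have := cycle_congruence gc Wc => Rc.
have mE : mdeg u = mdeg (u - cycle_exp true c) + mdeg (cycle_exp true c).
  by rewrite -mdegD submK.
apply: (@Rtrans _ (u - cycle_exp true c + cycle_exp false c)%MM).
  by rewrite -{1}(submK cu) ![(u - _ + _)%MM]addmC; apply: RD.
rewrite -{1}(submK cv); apply: RD; apply: IH.
- rewrite -ltnS; apply: leq_trans mu; rewrite ltnS mE -addn1 leq_add2l lt0n mdeg_eq0.
  apply/eqP => c0; have := deg_cycle_exp true gc; rewrite c0 deg0 => /mnmP.
  case: (c) gc => [[]//|z s] _ /(_ z); by rewrite mnm0E mnmE inE eqxx.
- apply: (@addIm _ (deg (cycle_exp true c))).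
  by rewrite -degD submK // dc -degD submK.
- move=> x h; apply: Wu; rewrite -(submK cu) degD mnmDE addn_gt0 h //.
Qed.

End Congruence.

End Exponents.

(** * Minimal generators of the kernel *)

Import GRing.Theory.
Local Open Scope ring_scope.

Section Ideal.
Variables (N : nat) (e : rel 'I_N) (A : {set 'I_N}).
Hypotheses (esym : ssrbool.symmetric e) (eirr : irreflexive e).
Hypothesis eA : forall x y, e x y -> (x \in A) != (y \in A).

Local Notation M := #|edges e|.
Implicit Types (c : seq 'I_N) (x y z : 'I_N) (u v w m : 'X_{1..M}) (i : 'I_M).

Lemma deg_gt1 m i j x : i != j -> (0 < m i)%N -> (0 < m j)%N ->
  x \in enum_val i -> x \in enum_val j -> (1 < deg m x)%N.
Proof.
move=> ij mi mj xi xj; rewrite mnmE (bigD1 i) //= (bigD1 j) /=; last first.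
  by rewrite xj eq_sym.
by move: mi mj; case: (m i) => // ?; case: (m j) => // ?; rewrite !addSn addnS.
Qed.

(** Only edges of the cycle are available, and the edge used at a vertex decides
    which one is used at the next: the matching alternates along the cycle, as
    the bipartition does. *)
Lemma chordless_matching c w : graph_cycle e c -> chordless e c ->
  deg w = vertices_exp c -> exists b, w = cycle_exp e A b c.
Proof.
move=> gc ch dw; have uc := graph_cycle_uniq gc.
have dwE x : deg w x = (x \in c : nat) by rewrite dw mnmE.
have nbr x i y : (0 < w i)%N -> enum_val i = [set x; y] -> e x y ->
    [/\ x \in c, y \in c & y = next c x \/ x = next c y].
  move=> wi iE exy.
  have dgt z : (0 < deg w z)%N -> z \in c by rewrite dwE lt0b.
  have xc : x \in c by apply/dgt/(deg_gt0 wi); rewrite iE !inE eqxx.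
  have yc : y \in c by apply/dgt/(deg_gt0 wi); rewrite iE !inE eqxx orbT.
  by apply/(cycle_edgesP _ _ uc); apply: ch.
(* [s x] tells whether the matching uses the edge leaving [x] *)
pose s x := [exists i, (0 < w i)%N && (enum_val i == [set x; next c x])].
have sP x : reflect (exists2 i, (0 < w i)%N & enum_val i = [set x; next c x]) (s x).
  by apply: (iffP existsP) => [[i /andP[? /eqP ?]]|[i ? /eqP ?]]; exists i => //; apply/andP.
have s_next x : x \in c -> s (next c x) = ~~ s x.
  move=> xc; have nc : next c x \in c by rewrite mem_next.
  have [/sP[i wi iE]|/sP nsx] := boolP (s x); apply/sP.
    case=> j wj jE; have ij : i != j.
      apply/eqP => ij; move: jE; rewrite -ij iE => /set2_inj[[E _]|[E _]].
        by have := graph_cycle_next gc xc; rewrite -E eirr.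
      have := next_neq_prev uc (proj2 gc) nc; rewrite prev_next // -E eqxx //.
    have := deg_gt1 (x := next c x) ij wi wj; rewrite iE jE !inE !eqxx orbT dwE.
    by rewrite nc => /(_ isT isT).
  have : (0 < deg w (next c x))%N by rewrite dwE nc.
  case/(deg_gt0P esym) => i [y [wi iE exy]].
  case: (nbr _ _ _ wi iE exy) => _ yc [yE|/(next_injective uc) xy].
    by exists i => //; rewrite iE yE.
  by case: nsx; exists i => //; rewrite iE -xy setUC.
have [x0 x0c] : exists x0, x0 \in c.
  by case: (c) gc => [[]//|x0 t] _; exists x0; rewrite inE eqxx.
pose b := (x0 \in A) == s x0; exists b.
have sE x : x \in c -> s x = ((x \in A) == b).
  move: x; apply: (next_closed uc x0c).
    by rewrite /b; case: (x0 \in A); case: (s x0).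
  move=> x xc; rewrite s_next // => ->; have := eA (graph_cycle_next gc xc).
  by case: b; case: (x \in A); case: (next c x \in A).
apply/mnmP => i; have [x [y [exy iE]]] := edgeP i.
have [wi|wi] := posnP (w i); last first.
  have : (w i <= deg w x)%N by rewrite mnmE (bigD1 i) ?leq_addr // iE !inE eqxx.
  have [xc yc xy] := nbr _ _ _ wi iE exy; rewrite dwE xc => wi1.
  have -> : w i = 1%N by apply/eqP; rewrite eqn_leq wi1 wi.
  symmetry; rewrite cycle_expE //; apply/eqP; rewrite eqb1; apply/hasP.
  have [z zc zE] : exists2 z, z \in c & enum_val i = [set z; next c z].
    by rewrite iE; case: xy => ->; [exists x|exists y; rewrite // setUC].
  by exists z; rewrite // zE eqxx andbT -sE //; apply/sP; exists i.
symmetry; rewrite wi; apply/eqP; rewrite -leqn0 leqNgt; apply/negP.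
case/(cycle_exp_gt0P eA gc) => z [zc zb zE].
have /sP[j wj jE] : s z by rewrite sE // zb.
by move: wj; rewrite (enum_val_inj (_ : enum_val j = enum_val i)) ?wi // jE zE.
Qed.

Lemma cycle_exp_no_common c m : graph_cycle e c ->
  (m <= cycle_exp e A true c)%MM -> (m <= cycle_exp e A false c)%MM -> m = 0%MM.
Proof.
move=> gc /mnm_lepP h1 /mnm_lepP h2; apply/mnmP => i; rewrite mnmE.
have [//|mi] := posnP (m i).
by case: (cycle_exp_disj eA gc (leq_trans mi (h1 i)) (leq_trans mi (h2 i))).
Qed.

Lemma cycle_exp_neq0 b c : graph_cycle e c -> cycle_exp e A b c != 0%MM.
Proof.
move=> gc; apply/eqP => c0; have := deg_cycle_exp eirr eA b gc; rewrite c0 deg0.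
by case: (c) gc => [[]//|z t] gc /mnmP/(_ z); rewrite !mnmE inE eqxx.
Qed.

Lemma cycle_exp_neq c : graph_cycle e c -> cycle_exp e A true c != cycle_exp e A false c.
Proof.
move=> gc; apply: contraNneq (cycle_exp_neq0 true gc) => E.
by apply/eqP; apply: (cycle_exp_no_common gc); rewrite ?E lepm_refl.
Qed.

(** A proper part of a matching of a chordless cycle is alone in its fiber:
    together with the missing edges, any [w'] in this fiber is a matching of the
    cycle which has edges in common with the first one, hence is equal to it. *)
Lemma chordless_submatching c m w w' : graph_cycle e c -> chordless e c ->
  m != 0%MM -> (m + w)%MM = cycle_exp e A true c -> deg w' = deg w -> w' = w.
Proof.
move=> gc ch m0 mw dw; have [[] E] : exists b, (m + w')%MM = cycle_exp e A b c.
  by apply: chordless_matching => //; rewrite degD dw -degD mw deg_cycle_exp.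
  by move: E; rewrite -mw => /addmI.
case/eqP: m0; apply: (cycle_exp_no_common gc); first by rewrite -mw lem_addr ?lepm_refl.
by rewrite -E lem_addr ?lepm_refl.
Qed.

Section Field.
Variable k : fieldType.
Implicit Types (p q : {mpoly k[M]}).

Local Notation inK p := (edge_map k e p = 0).

Lemma mpolyX_sum (n : nat) (I : Type) (r : seq I) (P : pred I) (F : I -> 'X_{1..n}) :
  \prod_(i <- r | P i) 'X_[F i] = 'X_[\sum_(i <- r | P i) F i] :> {mpoly k[n]}.
Proof. by symmetry; apply: (big_morph _ (@mpolyXD _ _) (@mpolyX0 _ _)). Qed.

Lemma edge_monE (E : {set 'I_N}) : edge_mon k E = 'X_[\sum_(x in E) U_(x)].
Proof. by rewrite /edge_mon mpolyX_sum. Qed.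

Lemma prod_edge_mon m :
  \prod_(i < M) edge_mon k (enum_val i) ^+ m i = 'X_[deg m].
Proof.
under eq_bigr do rewrite edge_monE mpolyXn.
rewrite mpolyX_sum; congr 'X_[_]; apply/mnmP => x.
rewrite mnm_sumE mnmE [RHS]big_mkcond /=; apply: eq_bigr => i _.
rewrite mulmnE mnm_sumE; case: ifP => xi.
  rewrite (bigD1 x) //= mnm1E eqxx big1 ?addn0 ?mul1n // => y /andP[_ /negPf yx].
  by rewrite mnm1E yx.
by rewrite big1 // => y yi; rewrite mnm1E; case: eqVneq => // yx; rewrite -yx yi in xi.
Qed.

Lemma edge_mapE p :
  edge_alg_val (edge_map k e p) = \sum_(m <- msupp p) p@_m *: 'X_[deg m].
Proof.
rewrite -[LHS]/(\val (edge_map k e p)) /edge_map /mmap raddf_sum.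
apply: eq_bigr => m _; rewrite mulr_algl.
transitivity (p@_m *: \val (mmap1 (@edge_gen k N e) m)); first by [].
rewrite -prod_edge_mon; congr (_ *: _).
by rewrite rmorph_prod; apply: eq_bigr => i _; rewrite rmorphXn.
Qed.

(** Membership in the kernel is a condition on each fiber separately. *)
Lemma edge_map_eq0 p : inK p <->
  forall d, \sum_(m <- msupp p | deg m == d) p@_m = 0.
Proof.
have cE d : (edge_alg_val (edge_map k e p))@_d =
    \sum_(m <- msupp p | deg m == d) p@_m.
  rewrite edge_mapE raddf_sum /= [RHS]big_mkcond /=; apply: eq_bigr => m _.
  by rewrite mcoeffZ mcoeffX; case: eqP => _; rewrite ?mulr1 ?mulr0.
split=> [p0 d|H]; first by rewrite -cE p0 mcoeff0.
by apply/val_inj/mpolyP => d; rewrite /= cE H mcoeff0.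
Qed.

Lemma edge_mapM p q : edge_map k e (p * q) = edge_map k e p * edge_map k e q.
Proof. exact: rmorphM. Qed.

Lemma edge_mapB p q : edge_map k e (p - q) = edge_map k e p - edge_map k e q.
Proof. exact: raddfB. Qed.

Lemma edge_mapX m : edge_alg_val (edge_map k e 'X_[m]) = 'X_[deg m].
Proof. by rewrite edge_mapE msuppX big_seq1 mcoeffX eqxx scale1r. Qed.

Lemma binomial_inK u v : deg u = deg v -> inK ('X_[u] - 'X_[v]).
Proof.
move=> uv; rewrite edge_mapB; apply/eqP; rewrite subr_eq0; apply/eqP.
by apply/val_inj; rewrite /= !edge_mapX uv.
Qed.

Lemma inK_coeff0 p u : inK p -> (forall v, deg v = deg u -> v = u) -> p@_u = 0.
Proof.
move=> /edge_map_eq0/(_ (deg u)) + uniq_u.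
rewrite (eq_bigl (pred1 u)) => [|m /=]; last first.
  by apply/eqP/eqP => [/uniq_u|->].
have [up|up] := boolP (u \in msupp p); last by move=> _; apply: memN_msupp_eq0.
by rewrite -big_filter filter_pred1_uniq ?msupp_uniq // big_seq1.
Qed.

(** On the kernel [K], the coefficient on a matching of a chordless cycle is a
    functional which kills the products of [K] with the maximal ideal of the
    origin, by [chordless_submatching]. *)
Lemma inK_mul_coeff c a q : graph_cycle e c -> chordless e c -> inK q ->
  (a * q)@_(cycle_exp e A true c) = a@_0%MM * q@_(cycle_exp e A true c).
Proof.
move=> gc ch qK; rewrite {1}[a]mpolyE mulr_suml raddf_sum /=.
have H m : m != 0%MM -> (a@_m *: 'X_[m] * q)@_(cycle_exp e A true c) = 0.
  move=> m0; rewrite -scalerAl mcoeffZ mulrC.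
  rewrite -[X in X * _ = _]/(('X_[m] * q)@_(cycle_exp e A true c)) [in X in X * _]mulrC.
  have [mc|mc] := boolP (m <= cycle_exp e A true c)%MM; last first.
    rewrite [X in X * _](_ : _ = 0) ?mul0r //; apply: memN_msupp_eq0.
    rewrite (perm_mem (msuppMX _ _)); apply/negP => /mapP[m' _ E].
    by move: mc; rewrite E lem_addr ?lepm_refl.
  rewrite -(submK mc) addmC mcoeffMX; set w := (_ - m)%MM.
  rewrite inK_coeff0 ?mul0r // => v; apply: chordless_submatching ch m0 _ => //.
  by rewrite addmC submK.
have [a0|a0] := boolP (0%MM \in msupp a).
  rewrite (bigD1_seq 0%MM) ?msupp_uniq //= big1 ?addr0; last by move=> m /H.
  by rewrite mpolyX0 -scalerAl mul1r mcoeffZ.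
rewrite big1_seq => [|m /andP[_ ma]]; last first.
  by apply: H; apply: contraNneq a0 => <-.
by rewrite (memN_msupp_eq0 a0) mul0r.
Qed.

(** One sequence [C j] is chosen for each chordless cycle, among those which
    differ from it by their origin and direction. *)
Section Enumeration.
Variables (n : nat) (C : 'I_n -> seq 'I_N).
Hypotheses (Cg : forall j, graph_cycle e (C j)) (Cch : forall j, chordless e (C j)).
Hypothesis Cinj : forall i j : 'I_n, C i =i C j -> i = j.
Hypothesis Csurj : forall c, graph_cycle e c -> chordless e c ->
  exists j, c =i C j.

Definition cycle_binomial j : {mpoly k[M]} :=
  'X_[cycle_exp e A true (C j)] - 'X_[cycle_exp e A false (C j)].

Lemma cycle_binomial_inK j : inK (cycle_binomial j).
Proof. by apply: binomial_inK; rewrite !deg_cycle_exp. Qed.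

Lemma cycle_binomial_coeff (i j : 'I_n) :
  (cycle_binomial i)@_(cycle_exp e A true (C j)) = (i == j)%:R.
Proof.
rewrite mcoeffB !mcoeffX; have [<-|ij] := eqVneq i j.
  by rewrite eqxx eq_sym (negPf (cycle_exp_neq (Cg i))) subr0.
have H b : cycle_exp e A b (C i) != cycle_exp e A true (C j).
  apply: contra_neq ij => E; apply: Cinj => x.
  have : deg (cycle_exp e A b (C i)) = deg (cycle_exp e A true (C j)) by rewrite E.
  rewrite !deg_cycle_exp // => /mnmP/(_ x); rewrite !mnmE.
  by case: (x \in C i); case: (x \in C j).
by rewrite !(negPf (H _)) subr0.
Qed.

(** By [inK_mul_coeff], expressing the binomials in the generators and taking
    coefficients on matchings factors the identity matrix of size [n] through
    size [h]. *)
Lemma chordless_le_generators h (s : h.-tuple {mpoly k[M]}) :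
  generates_ideal s (fun p => inK p) -> (n <= h)%N.
Proof.
move=> gen.
have sK (i : 'I_h) : inK (tnth s i).
  apply/gen; exists [tuple (i == j)%:R | j < h].
  rewrite (bigD1 i) //= tnth_mktuple eqxx mul1r big1 ?addr0 // => j ji.
  by rewrite tnth_mktuple eq_sym (negPf ji) mul0r.
have cE j : exists c : h.-tuple {mpoly k[M]},
    cycle_binomial j = \sum_(i < h) tnth c i * tnth s i.
  by apply/gen/cycle_binomial_inK.
pose P : 'M[k]_(n, h) := \matrix_(j, i) (tnth (projT1 (cid (cE j))) i)@_0%MM.
pose Q : 'M[k]_(h, n) := \matrix_(i, j) (tnth s i)@_(cycle_exp e A true (C j)).
apply: (@mulmx1_min _ _ _ P Q); apply/matrixP => i j; rewrite !mxE -cycle_binomial_coeff.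
rewrite {1}(projT2 (cid (cE i))) raddf_sum /=; apply: eq_bigr => l _.
by rewrite !mxE inK_mul_coeff.
Qed.

Section Generators.
Variables (h : nat) (hn : (n <= h)%N).

(** The list of binomials, padded with zeros. *)
Definition cycle_generators : h.-tuple {mpoly k[M]} :=
  [tuple if insub (val i) is Some j then cycle_binomial j else 0 | i < h].

Definition in_cycle_ideal p :=
  exists a : 'I_n -> {mpoly k[M]}, p = \sum_j a j * cycle_binomial j.

Lemma cycle_ideal_binomial j : in_cycle_ideal (cycle_binomial j).
Proof.
exists (fun l => (l == j)%:R); rewrite (bigD1 j) //= eqxx mul1r big1 ?addr0 // => i ij.
by rewrite (negPf ij) mul0r.
Qed.

Lemma cycle_idealD p q : in_cycle_ideal p -> in_cycle_ideal q -> in_cycle_ideal (p + q).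
Proof.
move=> [a ->] [b ->]; exists (fun j => a j + b j).
by rewrite -big_split; apply: eq_bigr => j _; rewrite mulrDl.
Qed.

Lemma cycle_idealM a p : in_cycle_ideal p -> in_cycle_ideal (a * p).
Proof.
move=> [b ->]; exists (fun j => a * b j).
by rewrite mulr_sumr; apply: eq_bigr => j _; rewrite mulrA.
Qed.

Lemma cycle_ideal0 : in_cycle_ideal 0.
Proof. by exists (fun=> 0); rewrite big1 // => j _; rewrite mul0r. Qed.

Lemma cycle_idealN p : in_cycle_ideal p -> in_cycle_ideal (- p).
Proof. by rewrite -mulN1r; apply: cycle_idealM. Qed.

Lemma binomial_cycle_ideal u v : deg u = deg v -> in_cycle_ideal ('X_[u] - 'X_[v]).
Proof.
move=> uv; pose R u v := in_cycle_ideal ('X_[u] - 'X_[v]); rewrite -/(R u v).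
apply: (@fiber_connected _ e A esym eirr eA predT R) => // {u v uv}.
- by move=> u; rewrite /R subrr; apply: cycle_ideal0.
- by move=> u v w h1 h2; have := cycle_idealD h1 h2; rewrite addrA subrK.
- by move=> w u v; rewrite /R !mpolyXD -mulrBl mulrC; apply: cycle_idealM.
move=> c gc ch _; have [j cj] := Csurj gc ch.
have dc b : deg (cycle_exp e A b c) = vertices_exp (C j).
  by rewrite deg_cycle_exp //; apply/mnmP => x; rewrite !mnmE cj.
have [b1 E1] := chordless_matching (Cg j) (@Cch j) (dc true).
have [b2 E2] := chordless_matching (Cg j) (@Cch j) (dc false).
rewrite /R E1 E2; case: b1 E1 => E1; case: b2 E2 => E2.
- by rewrite subrr; apply: cycle_ideal0.
- exact: cycle_ideal_binomial.
- by rewrite -opprB; apply/cycle_idealN/cycle_ideal_binomial.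
- by rewrite subrr; apply: cycle_ideal0.
Qed.

(** With each monomial, an element of the kernel contains another one of the
    same fiber; subtracting a multiple of their difference removes a monomial. *)
Lemma inK_cycle_ideal p : inK p -> in_cycle_ideal p.
Proof.
have [r] := ubnP (size (msupp p)); elim: r p => // r IH p sp pK.
have [->|p0] := eqVneq p 0; first exact: cycle_ideal0.
have [u up] : exists u, u \in msupp p.
  move: p0; rewrite -msupp_eq0; case: (msupp p : seq _) => // u t _.
  by exists u; rewrite inE eqxx.
have [v [vp vu dvu]] : exists v, [/\ v \in msupp p, v != u & deg v = deg u].
  apply: contrapT => H; move: up; rewrite mcoeff_msupp => /negP; apply; apply/eqP.
  have := (edge_map_eq0 p).1 pK (deg u).
  have [up|/memN_msupp_eq0 //] := boolP (u \in msupp p).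
  rewrite big_mkcond (bigD1_seq u) ?msupp_uniq //= eqxx big1_seq ?addr0 //.
  move=> v /andP[vu vp]; case: eqP => // dv.
  by case: H; exists v.
pose B : {mpoly k[M]} := 'X_[u] - 'X_[v].
pose q := p - (p@_u)%:MP * B.
have BK : inK B by apply: binomial_inK.
have qK : inK q by rewrite edge_mapB edge_mapM pK BK mulr0 subrr.
have -> : p = q + (p@_u)%:MP * B by rewrite subrK.
apply: cycle_idealD; last by apply/cycle_idealM/binomial_cycle_ideal.
apply: IH => //; rewrite -ltnS; apply: leq_trans sp; rewrite ltnS.
have qu : u \notin msupp q.
  rewrite mcoeff_msupp negbK mcoeffB mcoeffCM mcoeffB !mcoeffX eqxx (negPf vu).
  by rewrite subr0 mulr1 subrr.
have sub : {subset u :: msupp q <= msupp p}.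
  move=> w; rewrite inE => /orP[/eqP->//|wq]; move: (wq); rewrite !mcoeff_msupp.
  rewrite mcoeffB mcoeffCM mcoeffB !mcoeffX.
  have uw : u != w by apply: contraNneq qu => ->.
  have [<- _|_] := eqVneq v w; first by rewrite -mcoeff_msupp.
  by rewrite (negPf uw) subrr mulr0 subr0.
have := uniq_leq_size _ sub; rewrite /= qu msupp_uniq; exact.
Qed.

Lemma cycle_ideal_inK p : in_cycle_ideal p -> inK p.
Proof.
move=> [a ->]; rewrite /edge_map raddf_sum big1 // => j _.
by rewrite -[LHS]/(edge_map k e _) edge_mapM cycle_binomial_inK mulr0.
Qed.

Lemma cycle_generators_generate : generates_ideal cycle_generators (fun p => inK p).
Proof.
move=> p; split=> [/inK_cycle_ideal[a pE]|[c ->]].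
  exists [tuple if insub (val i) is Some j then a j else 0 | i < h].
  pose F l := if insub l is Some j then a j * cycle_binomial j else 0.
  transitivity (\sum_(j < n) F j).
    by rewrite pE; apply: eq_bigr => j _; rewrite /F valK.
  rewrite (big_ord_widen _ F hn) big_mkcond; apply: eq_bigr => i _.
  by rewrite !tnth_mktuple /F; case: insubP => [j ->|/negPf ->] //; rewrite mul0r.
apply: cycle_ideal_inK; elim/big_rec: _ => [|i q _ qJ]; first exact: cycle_ideal0.
apply: cycle_idealD => //; apply: cycle_idealM; rewrite tnth_mktuple.
by case: insub => [j|]; [apply: cycle_ideal_binomial|apply: cycle_ideal0].
Qed.

End Generators.
End Enumeration.
End Field.
End Ideal.

(** * Krull dimension of the edge algebra *)

Section KernelPrime.
Variables (R : comNzRingType) (S : idomainType) (f : {rmorphism R -> S}).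

Definition kernel : R -> bool := fun a => f a == 0.

Lemma kernel_idealr : idealr_closed kernel.
Proof.
split; rewrite ?unfold_in /kernel ?rmorph0 ?rmorph1 ?oner_eq0 //.
move=> a u v; rewrite !unfold_in /= => /eqP fu /eqP fv.
by rewrite rmorphD rmorphM fu fv mulr0 addr0.
Qed.

Lemma kernel_prime : prime_idealr_closed kernel.
Proof. by move=> u v; rewrite !unfold_in /kernel rmorphM mulf_eq0. Qed.

HB.instance Definition _ := isIdealr.Build R kernel kernel_idealr.
HB.instance Definition _ := isPrimeIdealrClosed.Build R kernel kernel_prime.

Definition kernel_ideal : prime_idealr R := kernel.

End KernelPrime.

(** Choose [t j] in [P j.+1] but not in [P j]. Divide a relation by the least
    power of [t 0] which occurs (allowed because [t 0] is not in the first prime) and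
    read it modulo the second prime, which contains [t 0]: only the terms with
    this least power remain, and they form a relation between the other [t j]. In
    the end a single coefficient remains, which cannot be a unit. *)
Lemma prime_chain_independent (R : comNzRingType) (n : nat)
    (P : 'I_n.+1 -> prime_idealr R) : prime_chain P ->
  exists t : 'I_n -> R, forall m (c : {ffun 'I_n -> 'I_m} -> R),
    (forall s, c s = 0 \/ exists d, d * c s = 1) ->
    \sum_s c s * \prod_i t i ^+ s i = 0 -> forall s, c s = 0.
Proof.
move=> chP; pose Q j := P (inord j).
have [t tP] : exists t : 'I_n -> R, forall i : 'I_n, t i \in Q i.+1 /\ t i \notin Q i.
  have H (i : 'I_n) : exists x, x \in Q i.+1 /\ x \notin Q i.
    have [|_ [x x1 x2]] := chP (inord i) (inord i.+1); last by exists x.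
    by rewrite !inordK // ltnS // ltnW.
  by exists (fun i => projT1 (cid (H i))) => i; exact: (projT2 (cid (H i))).
have Qsub j : (j < n)%N -> {subset Q j <= Q j.+1}.
  move=> jn; have [|] := chP (inord j) (inord j.+1); last by [].
  by rewrite !inordK // ltnS // ltnW.
exists t => m c cu c0.
suff H d (S : {set {ffun 'I_n -> 'I_m}}) j : (j + d = n)%N ->
    (exists s, s \in S) -> (forall s, s \in S -> exists d, d * c s = 1) ->
    (forall s s', s \in S -> s' \in S -> forall i : 'I_n, (i < j)%N -> s i = s' i) ->
    \sum_(s in S) c s * \prod_(i < n | (j <= i)%N) t i ^+ s i \in Q j -> False.
  move=> s; case: (cu s) => // us; exfalso.
  apply: (H n [set s | c s != 0] 0%N) => //.
  - exists s; rewrite inE; apply/eqP => cs; case: us => d; rewrite cs mulr0 => /eqP.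
    by rewrite eq_sym oner_eq0.
  - by move=> s'; rewrite inE; case: (cu s') => [->|//]; rewrite eqxx.
  - have -> : \sum_(s in [set s | c s != 0]) c s * \prod_(i < n | (0 <= i)%N) t i ^+ s i = 0.
      rewrite -[RHS]c0 [RHS](bigID (fun s => c s != 0)) /= [X in _ = _ + X]big1 ?addr0.
        by apply: eq_big => [s'|s' _]; rewrite ?inE.
      by move=> s'; rewrite negbK => /eqP->; rewrite mul0r.
    exact: rpred0.
elim: d S j => [|d IH] S j jn [s0 s0S] Su agree sumQ.
  have jn' : j = n by rewrite addn0 in jn.
  (* all the exponents are fixed by now *)
  have S1 : S = [set s0].
    apply/setP => s; rewrite inE; apply/idP/eqP => [sS|-> //].
    by apply/ffunP => i; apply: agree => //; rewrite jn'.
  move: sumQ; rewrite S1 big_set1 big1 ?mulr1 => [cQ|i]; last first.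
    by rewrite leqNgt jn' ltn_ord.
  have [d dc] := Su s0 s0S.
  by have := idealMr d cQ; rewrite dc idealr1.
have jltn : (j < n)%N by rewrite -jn addnS ltnS leq_addr.
pose jo := Ordinal jltn.
case: (arg_minnP (fun s : {ffun 'I_n -> 'I_m} => s jo : nat) s0S) => s1 s1S min1.
pose B (s : {ffun 'I_n -> 'I_m}) := \prod_(i < n | (j < i)%N) t i ^+ s i.
have prodE (s : {ffun 'I_n -> 'I_m}) :
    \prod_(i < n | (j <= i)%N) t i ^+ s i = t jo ^+ s jo * B s.
  rewrite (bigD1 jo) //=; congr (_ * _); apply: eq_bigl => i.
  by rewrite ltn_neqAle andbC -val_eqE /= eq_sym.
have {}sumQ : \sum_(s in S) c s * (t jo ^+ (s jo - s1 jo) * B s) \in Q j.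
  have : t jo ^+ s1 jo * \sum_(s in S) c s * (t jo ^+ (s jo - s1 jo) * B s) \in Q j.
    rewrite (_ : _ * _ = \sum_(s in S) c s * \prod_(i < n | (j <= i)%N) t i ^+ s i) //.
    rewrite mulr_sumr; apply: eq_bigr => s sS; rewrite prodE mulrCA; congr (_ * _).
    by rewrite mulrA -exprD subnKC // min1.
  rewrite prime_idealrM => /orP[|//] h; exfalso; move: h.
  elim: (nat_of_ord (s1 jo)) => [|k IHk]; first by rewrite expr0 idealr1.
  by rewrite exprS prime_idealrM (negPf (proj2 (tP jo))).
pose S' := [set s in S | s jo == s1 jo].
apply: (IH S' j.+1).
- by rewrite addSnnS.
- by exists s1; rewrite inE eqxx andbT.
- by move=> s; rewrite inE => /andP[/Su].
- move=> s s'; rewrite !inE => /andP[sS /eqP sj] /andP[s'S /eqP s'j] i.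
  rewrite ltnS leq_eqVlt => /orP[/eqP ij|]; last exact: agree.
  have -> : i = jo by apply/val_inj.
  by rewrite sj s'j.
have -> : \sum_(s in S') c s * \prod_(i < n | (j < i)%N) t i ^+ s i =
   \sum_(s in S) c s * (t jo ^+ (s jo - s1 jo) * B s) -
   \sum_(s in S | s jo != s1 jo) c s * (t jo ^+ (s jo - s1 jo) * B s).
  rewrite [X in _ = X - _](bigID (fun s : {ffun 'I_n -> 'I_m} => s jo == s1 jo)) /= addrK.
  apply: eq_big => s; rewrite ?inE // => /andP[_ /eqP->].
  by rewrite subnn expr0 mul1r.
apply: rpredB; first exact: Qsub.
apply: rpred_sum => s /andP[sS sj]; apply: idealMr; rewrite mulrC; apply: idealMr.
have : (0 < s jo - s1 jo)%N by rewrite subn_gt0 ltn_neqAle eq_sym sj min1.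
case: (_ - _)%N => // k _; rewrite exprSr; apply: idealMr.
exact: (proj1 (tP jo)).
Qed.

Section Krull.
Variables (N : nat) (e : rel 'I_N) (A : {set 'I_N}).
Hypotheses (esym : ssrbool.symmetric e) (eirr : irreflexive e).
Hypothesis eA : forall x y, e x y -> (x \in A) != (y \in A).
Variable k : fieldType.

Local Notation M := #|edges e|.
Local Notation kG := (edge_alg k e).

Definition nonroots : {set 'I_N} := [set x | fingraph.root e x != x].

(** In each connected component the degrees on the two sides of the bipartition
    have the same sum, since an edge counts once in each; this determines the
    degree at the root. *)
Lemma deg_nonroots (u v : 'X_{1..M}) :
  {in nonroots, forall x, deg u x = deg v x} -> deg u = deg v.
Proof.
move=> H; have cs := sym_connect_sym esym; apply/mnmP => x.
have [rx|] := eqVneq (fingraph.root e x) x; last by move=> rx; apply: H; rewrite inE.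
pose side (w : 'X_{1..M}) b :=
  (\sum_(y | (fingraph.root e y == x) && ((y \in A) == b)) deg w y)%N.
have sideE w : side w true = side w false.
  have E b : side w b =
      (\sum_(i < M | [exists y in enum_val i, fingraph.root e y == x]) w i)%N.
    rewrite /side; under eq_bigr do rewrite mnmE.
    rewrite (exchange_big_dep predT) //= [RHS]big_mkcond /=; apply: eq_bigr => i _.
    have [y [z [eyz iE]]] := edgeP i.
    have ryz : fingraph.root e y = fingraph.root e z by apply/(fingraph.rootP cs)/connect1.
    have -> : [exists y in enum_val i, fingraph.root e y == x] = (fingraph.root e y == x).
      apply/existsP/idP => [[t]|ry]; last by exists y; rewrite iE !inE eqxx.
      by rewrite iE !inE => /andP[/orP[]/eqP->]; rewrite ?ryz.
    case: ifP => [ry|nry]; last first.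
      rewrite big1 // => t; rewrite iE !inE => /andP[/andP[rt _] /orP[]/eqP tE].
        by rewrite tE nry in rt.
      by rewrite tE -ryz nry in rt.
    (* an edge has exactly one end on the side [b] *)
    have [t tE] : exists t, forall s,
        ((fingraph.root e s == x) && ((s \in A) == b)) && (s \in enum_val i) = (s == t).
      have yzA := eA eyz; have nyz : y != z by apply: contraTneq eyz => ->; rewrite eirr.
      exists (if (y \in A) == b then y else z) => s; rewrite iE !inE.
      have [->|ny] := eqVneq s y.
        by rewrite ry; case: ifP => _; rewrite /= ?eqxx ?(negPf nyz).
      have [->|nz] := eqVneq s z; last first.
        by rewrite andbF; case: ifP; rewrite ?(negPf ny) ?(negPf nz).
      rewrite -ryz ry; move: yzA; case: b; case: (y \in A); case: (z \in A) => //= _;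
        by rewrite ?eqxx // eq_sym (negPf nyz).
    by rewrite (eq_bigl _ _ tE) big_pred1_eq.
  by rewrite !E.
have sideD w : side w (x \in A) =
   (deg w x + \sum_(y | (fingraph.root e y == x) && ((y \in A) == (x \in A))
      && (y != x)) deg w y)%N.
  by rewrite /side (bigD1 x) //= rx !eqxx.
have other b : b != (x \in A) -> side u b = side v b.
  move=> bx; apply: eq_bigr => y /andP[/eqP ry /eqP yb]; apply: H.
  by rewrite inE ry; apply: contraNneq bx => ->; rewrite yb.
have : side u (x \in A) = side v (x \in A).
  have := other (~~ (x \in A)).
  by case: (x \in A) => /(_ isT); rewrite !sideE ?sideE // -!sideE.
rewrite !sideD => E; apply/eqP; rewrite -(eqn_add2r (\sum_(y | (fingraph.root e y == x)
  && ((y \in A) == (x \in A)) && (y != x)) deg u y)).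
rewrite E eqn_add2l; apply/eqP; apply: eq_bigr => y /andP[/andP[/eqP ry _] yx].
by symmetry; apply: H; rewrite inE ry eq_sym.
Qed.

Definition edge_monomial (m : 'X_{1..N}) := exists w : 'X_{1..M}, m = deg w.

Lemma edge_alg_msupp (a : kG) m : m \in msupp (edge_alg_val a) -> edge_monomial m.
Proof.
case: a => a /= /asboolP aP; pose S : {pred {mpoly k[N]}} :=
  fun p => `[< forall m, m \in msupp p -> edge_monomial m >].
suff /asboolP/(_ m) : a \in S by [].
apply: aP => [|E EE].
  split.
  - apply/asboolP => m'; rewrite msupp1 inE => /eqP->; exists 0%MM; by rewrite deg0.
  - move=> c u v /asboolP uS /asboolP vS; apply/asboolP => m' /msuppD_le.
    by rewrite mem_cat => /orP[/msuppZ_le/uS|/vS].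
  - move=> u v /asboolP uS /asboolP vS; apply/asboolP => m' /msuppM_le/allpairsP.
    case=> -[m1 m2] /= [/uS[w1 ->] /vS[w2 ->] ->]; exists (w1 + w2)%MM.
    by rewrite degD.
apply/asboolP => m'; have [i <-] : exists i : 'I_M, enum_val i = E.
  by exists (enum_rank_in EE E); rewrite enum_rankK_in.
rewrite edge_monE msuppX inE => /eqP->; exists U_(i)%MM.
have [y [z [eyz iE]]] := edgeP i; rewrite -(edge_expE iE) deg_edge_exp // iE.
by rewrite big_setU1 ?big_set1 // inE; apply: contraTneq eyz => ->; rewrite eirr.
Qed.

Definition mdeg_bounded (b : nat) (p : {mpoly k[N]}) :=
  forall m, m \in msupp p -> (mdeg m <= b)%N.

Lemma mdeg_boundedM b1 b2 p q : mdeg_bounded b1 p -> mdeg_bounded b2 q ->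
  mdeg_bounded (b1 + b2) (p * q).
Proof.
move=> H1 H2 m /msuppM_le/allpairsP[[m1 m2] /= [/H1 h1 /H2 h2 ->]].
by rewrite mdegD leq_add.
Qed.

Lemma mdeg_boundedX b p n : mdeg_bounded b p -> mdeg_bounded (n * b) (p ^+ n).
Proof.
move=> H; elim: n => [|n IH]; last by rewrite exprS mulSn; apply: mdeg_boundedM.
by move=> m; rewrite expr0 msupp1 inE => /eqP->; rewrite mdeg0.
Qed.

Lemma mdeg_bounded_prod n b (F : 'I_n -> {mpoly k[N]}) :
  (forall i, mdeg_bounded b (F i)) -> mdeg_bounded (n * b) (\prod_i F i).
Proof.
move=> H; rewrite -[X in (X * _)%N]card_ord -sum_nat_const.
elim/big_rec2: _ => [|i q p _ IH]; last exact: mdeg_boundedM.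
by move=> m; rewrite msupp1 inE => /eqP->; rewrite mdeg0.
Qed.

Lemma mdeg_bounded_le b b' p : (b <= b')%N -> mdeg_bounded b p -> mdeg_bounded b' p.
Proof. by move=> h H m /H h'; apply: leq_trans h' h. Qed.

Lemma growth_le n r D : (forall m, m ^ n <= (n * (m * D)).+1 ^ r)%N -> (n <= r)%N.
Proof.
move=> H; rewrite leqNgt; apply/negP => rn.
pose B := ((n * D).+1 ^ r)%N; have := H B.+1; apply/negP; rewrite -ltnNge.
have h1 : ((n * (B.+1 * D)).+1 ^ r <= B.+1 ^ r * B)%N.
  rewrite -expnMn; case: (r) => // r'; rewrite leq_exp2r //; nia.
have h2 : (B.+1 ^ r * B.+1 <= B.+1 ^ n)%N by rewrite -expnSr leq_pexp2l.
apply: leq_ltn_trans h1 _; apply: leq_trans h2.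
by rewrite ltn_pmul2l // expn_gt0.
Qed.

Lemma rank_lt_kernel m n (T : 'M[k]_(m, n)) : (n < m)%N ->
  exists2 v : 'rV[k]_m, v != 0 & v *m T = 0.
Proof.
move=> nm; have : kermx T != 0.
  rewrite kermx_eq0 -row_leq_rank -ltnNge; exact: leq_ltn_trans (rank_leq_col T) nm.
by case/rowV0Pn=> v /sub_kermxP vT v0; exists v.
Qed.

(** Let [t] be the [n] independent elements of [prime_chain_independent], of
    degree at most [D]. The [m ^ n] monomials in [t] with exponents below [m] are
    linearly independent, and their own monomials are determined by [#|nonroots|]
    exponents below [L], which grows linearly with [m]. *)
Lemma krull_le n (P : 'I_n.+1 -> prime_idealr kG) :
  prime_chain P -> (n <= #|nonroots|)%N.
Proof.
move=> chP; set r := #|nonroots|.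
have [t indep] := prime_chain_independent chP.
pose D := (\max_(i < n) msize (edge_alg_val (t i)))%N.
have tD i : mdeg_bounded D (edge_alg_val (t i)).
  move=> m /msize_mdeg_lt/ltnW h; apply: leq_trans h _.
  exact: (@leq_bigmax _ (fun i => msize (edge_alg_val (t i))) i).
apply: (@growth_le n r D) => m; set L := _.+1.
rewrite leqNgt; apply/negP => lt.
pose T : finType := {ffun 'I_n -> 'I_m}; pose G : finType := {ffun 'I_r -> 'I_L}.
have ltGT : (#|G| < #|T|)%N by rewrite !card_ffun !card_ord.
pose mon (s : T) : kG := \prod_i t i ^+ s i.
have mon_bounded s : mdeg_bounded (n * (m * D)) (edge_alg_val (mon s)).
  rewrite -[edge_alg_val _]/(\val (mon s)) rmorph_prod.
  apply: mdeg_bounded_prod => i; rewrite rmorphXn.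
  apply: (@mdeg_bounded_le (s i * D)); first by rewrite leq_mul2r (ltnW (ltn_ord _)) orbT.
  by apply: mdeg_boundedX; apply: tD.
pose lifts (g : G) (w : 'X_{1..M}) :=
  forall l : 'I_r, deg w (enum_val l) = g l :> nat.
(* the monomial of the edge algebra with given exponents off the roots *)
pose ext (g : G) : 'X_{1..N} :=
  if pselect (exists w, lifts g w) is left h then deg (projT1 (cid h)) else 0%MM.
have extE g w : lifts g w -> ext g = deg w.
  move=> gw; rewrite /ext; case: pselect => [h|[]]; last by exists w.
  apply: deg_nonroots => x xr; have := projT2 (cid h) (enum_rank_in xr x).
  by rewrite -gw enum_rankK_in.
pose Tm : 'M[k]_(#|T|, #|G|) :=
  \matrix_(a, b) (edge_alg_val (mon (enum_val a)))@_(ext (enum_val b)).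
have [v v0 vT] := rank_lt_kernel Tm ltGT.
pose c (s : T) : kG := (v 0 (enum_rank s))%:A.
have c_unit s : c s = 0 \/ exists d, d * c s = 1.
  have [z|nz] := eqVneq (v 0 (enum_rank s)) 0; first by left; rewrite /c z scale0r.
  right; exists ((v 0 (enum_rank s))^-1)%:A.
  by rewrite /c -scalerAl mul1r scalerA mulVf // scale1r.
have sum0 : \sum_s c s * \prod_i t i ^+ s i = 0.
  apply/val_inj/mpolyP => mu; rewrite raddf_sum raddf_sum mcoeff0.
  have cE s : (\val (c s * mon s))@_mu = v 0 (enum_rank s) * (edge_alg_val (mon s))@_mu.
    by rewrite /c mulr_algl -mcoeffZ.
  rewrite (eq_bigr _ (fun s _ => cE s)).
  have [[s smu]|nos] := pselect (exists s, mu \in msupp (edge_alg_val (mon s))); last first.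
    apply: big1 => s _; rewrite memN_msupp_eq0 ?mulr0 //.
    by apply/negP => h; apply: nos; exists s.
  have [w muE] := edge_alg_msupp smu.
  have wL (l : 'I_r) : (deg w (enum_val l) < L)%N.
    rewrite ltnS -muE; apply: leq_trans (mon_bounded s _ smu).
    by rewrite mdegE (bigD1 (enum_val l)) //= leq_addr.
  pose g : G := [ffun l => Ordinal (wL l)].
  have gw : lifts g w by move=> l; rewrite ffunE.
  have /matrixP/(_ 0 (enum_rank g)) := vT; rewrite !mxE => E; rewrite -[RHS]E.
  rewrite (reindex (@enum_val T T)) /=; last first.
    by exists enum_rank => ? _; rewrite ?enum_valK ?enum_rankK.
  by apply: eq_bigr => a _; rewrite mxE enum_valK enum_rankK (extE _ _ gw) -muE.
have := indep m c c_unit sum0 => c0.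
case/eqP: v0; apply/rowP => a; rewrite mxE.
have /eqP := c0 (enum_val a); rewrite /c enum_valK.
by rewrite -[_%:A]/(in_alg kG _) fmorph_eq0 => /eqP.
Qed.

(** An order in which the vertices can be deleted so that each one still has a
    neighbour when it goes: from the leaves of a spanning forest to the roots. It
    is built from its end, by adding to a set [B] a vertex adjacent to [B]. *)
Lemma elimination_order : exists s : seq 'I_N, [/\ size s = #|nonroots|, uniq s &
  forall x0 i, (i < size s)%N ->
    exists2 w, e (nth x0 s i) w & w \notin take i.+1 s].
Proof.
have cs := sym_connect_sym esym.
suff H n (B : {set 'I_N}) : #|~: B| = n -> (forall x, fingraph.root e x \in B) ->
  exists s : seq 'I_N, [/\ size s = n, uniq s, {in s, forall x, x \notin B} &
  forall x0 i, (i < size s)%N -> exists2 w, e (nth x0 s i) w & w \notin take i.+1 s].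
  have [||s [s1 s2 _ s4]] := H #|nonroots| (~: nonroots); last by exists s.
    by rewrite setCK.
  by move=> x; rewrite !inE negbK root_root.
elim: n B => [|n IH] B cB rB; first by exists [::].
have [x xB] : exists x, x \notin B.
  by have /card_gt0P[x] : (0 < #|~: B|)%N by [rewrite cB]; rewrite inE; exists x.
have [y [w [yB wB eyw]]] : exists y w, [/\ y \notin B, w \in B & e y w].
  apply: contrapT => H; have cl : closed e B.
    move=> y w eyw; apply/idP/idP => h; apply: contrapT => /negP nh; apply: H.
      by exists w, y; rewrite esym.
    by exists y, w.
  by have := closed_connect cl (connect_root e x); rewrite rB (negPf xB).
have [||s [s1 s2 s3 s4]] := IH (y |: B).
- apply/eqP; rewrite -eqSS -cB (cardsD1 y (~: B)) inE yB add1n eqSS; apply/eqP.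
  by congr #|pred_of_set _|; apply/setP => z; rewrite !inE negb_or.
- by move=> z; rewrite inE rB orbT.
have ys : y \notin s by apply/negP => /s3; rewrite !inE eqxx.
exists (rcons s y); split; rewrite ?size_rcons ?s1 //.
- by rewrite rcons_uniq ys s2.
- by move=> z; rewrite mem_rcons inE => /orP[/eqP->//|/s3]; rewrite inE negb_or => /andP[].
move=> x0 i; rewrite ltnS leq_eqVlt -s1 => /orP[/eqP->|hi].
  rewrite nth_rcons ltnn eqxx; exists w => //.
  rewrite take_oversize ?size_rcons // mem_rcons inE negb_or.
  apply/andP; split; first by apply: contraNneq yB => <-.
  by apply/negP => /s3; rewrite inE wB orbT.
have [w' e1 w1] := s4 x0 i hi; exists w'; first by rewrite nth_rcons hi.
by rewrite -cats1 takel_cat.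
Qed.

Definition kill_vertices (D : seq 'I_N) : {mpoly k[N]} -> {mpoly k[N]} :=
  mmap (@mpolyC N k) (fun x => if x \in D then 0 else 'X_x).

HB.instance Definition _ D := GRing.RMorphism.on (kill_vertices D).

Lemma kill_vertices_eq0 D p : kill_vertices D p = 0 <->
  forall m : 'X_{1..N}, (forall x, x \in D -> m x = 0%N) -> p@_m = 0.
Proof.
have E (m : 'X_{1..N}) : mmap1 (fun x => if x \in D then 0 else 'X_x) m =
    (if [forall x in D, m x == 0%N] then 'X_[m] else 0) :> {mpoly k[N]}.
  rewrite /mmap1; case: ifP => [/forallP h|/negbT].
    rewrite [RHS]mpolyXE_id; apply: eq_bigr => x _; case: ifP => // xD.
    by have := h x; rewrite xD => /eqP->; rewrite !expr0.
  rewrite negb_forall => /existsP[x]; rewrite negb_imply => /andP[xD mx].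
  by rewrite (bigD1 x) //= xD expr0n (negPf mx) mul0r.
have cE m : (kill_vertices D p)@_m = if [forall x in D, m x == 0%N] then p@_m else 0.
  rewrite /kill_vertices /mmap raddf_sum /=.
  transitivity (\sum_(i <- msupp p)
      (if [forall x in D, i x == 0%N] then p@_i * (i == m)%:R else 0)).
    apply: eq_bigr => i _; rewrite mcoeffCM E; case: ifP => _; rewrite ?mcoeffX ?mcoeff0 ?mulr0 //.
  have [mp|mp] := boolP (m \in msupp p).
    rewrite (bigD1_seq m) ?msupp_uniq //= eqxx mulr1 big1 ?addr0 // => i /negPf->.
    by rewrite mulr0 if_same.
  rewrite (memN_msupp_eq0 mp) if_same big1_seq // => i /andP[_ ip].
  by rewrite (_ : (i == m) = false) ?mulr0 ?if_same //; apply: contraNF mp => /eqP <-.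
split=> [p0 m mD|H].
  have := cE m; rewrite p0 mcoeff0; case: ifP => // /negP[].
  by apply/forallP => x; apply/implyP => /mD->.
apply/mpolyP => m; rewrite cE mcoeff0; case: ifP => // /forallP h; apply: H => x xD.
by have := h x; rewrite xD => /eqP.
Qed.

(** Take the kernels of the maps which kill an initial segment of the elimination
    order. They increase strictly: the edge which a vertex has left when it
    is deleted is killed only from then on. *)
Lemma krull_chain : exists P : 'I_#|nonroots|.+1 -> prime_idealr kG, prime_chain P.
Proof.
have [s [<- us sP]] := elimination_order.
pose P (i : 'I_(size s).+1) : prime_idealr kG :=
  kernel_ideal (kill_vertices (take i s) \o (\val : kG -> {mpoly k[N]})).
have PE i a : a \in P i <-> kill_vertices (take i s) (\val a) = 0.
  by rewrite unfold_in /=; split=> /eqP.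
exists P => i j ij; split=> [a|].
  move=> /PE/kill_vertices_eq0 H; apply/PE/kill_vertices_eq0 => m mj; apply: H => x xi.
  apply: mj; rewrite -(subnKC (ltnW ij)) takeD mem_cat xi //.
have hi : (i < size s)%N by apply: leq_trans ij _; rewrite -ltnS.
have [x0 _] : exists x0 : 'I_N, true.
  by have := leq_ltn_trans (leq0n i) hi; case: (s) => // x0 t _; exists x0.
have [w eyw wD] := sP x0 i hi; set y := nth x0 s i in eyw.
have [l lE] := edge_index eyw.
have aE : \val (@edge_gen k N e l) = 'X_[U_(y) + U_(w)].
  rewrite /= lE edge_monE big_setU1 ?big_set1 // inE.
  by apply: contraTneq eyw => ->; rewrite eirr.
exists (@edge_gen k N e l).
  apply/PE; rewrite aE; apply/kill_vertices_eq0 => m mj.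
  rewrite mcoeffX; case: eqP => // mE; exfalso.
  have yj : y \in take j s by rewrite /y -(nth_take x0 ij) mem_nth // size_take_min leq_min ij.
  by have := mj y yj; rewrite -mE mnmDE !mnm1E eqxx.
apply/negP => /PE; rewrite aE => /kill_vertices_eq0/(_ (U_(y) + U_(w))%MM).
rewrite mcoeffX eqxx => H; suff /H/eqP : forall x, x \in take i s -> (U_(y) + U_(w))%MM x = 0%N.
  by rewrite oner_eq0.
move=> x xi; rewrite mnmDE !mnm1E; apply/eqP; rewrite addn_eq0 !eqb0; apply/andP; split.
  apply: contraTneq xi => <-.
  have := us; rewrite -{1}(cat_take_drop i.+1 s) cat_uniq => /and3P[+ _ _].
  by rewrite (take_nth x0 hi) rcons_uniq => /andP[].
by apply: contraTneq xi => <-; apply: contra wD;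
  rewrite (take_nth x0 hi) mem_rcons inE => ->; rewrite orbT.
Qed.

Theorem krull_dim_edge_alg : has_krull_dim kG #|nonroots|.
Proof. by split; [exact: krull_chain|move=> n P; apply: krull_le]. Qed.

End Krull.

(** * The rational cycle space *)

Section CycleSpace.
Variables (N : nat) (e : rel 'I_N) (A : {set 'I_N}).
Hypotheses (esym : ssrbool.symmetric e) (eirr : irreflexive e).
Hypothesis eA : forall x y, e x y -> (x \in A) != (y \in A).

Local Notation M := #|edges e|.
Local Notation r := #|nonroots e|.
Implicit Types (c p q : seq 'I_N) (x y z : 'I_N) (u v w m : 'X_{1..M}) (i : 'I_M).

Definition exp_vec m : 'rV[rat]_M := \row_i (m i)%:R.

Lemma exp_vecD m1 m2 : exp_vec (m1 + m2)%MM = exp_vec m1 + exp_vec m2.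
Proof. by apply/rowP => i; rewrite !mxE mnmDE natrD. Qed.

(** The columns of the roots are left out as redundant, see [deg_nonroots]. *)
Definition incidence : 'M[rat]_(M, r) :=
  \matrix_(i < M, l < r) (enum_val l \in enum_val i)%:R.

Lemma exp_vec_incidence m : exp_vec m *m incidence = \row_l (deg m (enum_val l))%:R.
Proof.
apply/rowP => l; rewrite !mxE mnmE natr_sum [RHS]big_mkcond /=.
apply: eq_bigr => i _; rewrite !mxE.
by case: ifP => _; rewrite ?mulr1 ?mulr0.
Qed.

(** A relation between the columns is a function on the vertices which is zero on
    the roots and changes sign along each edge; so it is zero on each connected
    component. *)
Lemma rank_incidence : \rank incidence = r.
Proof.
apply/eqP; rewrite -mxrank_tr -/(row_free _) -kermx_eq0; apply/rowV0P => f.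
move/sub_kermxP => fB.
pose g x := \sum_(l < r | enum_val l == x) f 0 l.
have gE l : g (enum_val l) = f 0 l.
  by rewrite /g (eq_bigl (pred1 l)) ?big_pred1_eq // => l'; rewrite (inj_eq enum_val_inj).
have ge x y : e x y -> g x + g y = 0.
  move=> exy; have [i iE] := edge_index exy.
  have := congr1 (fun R : 'rV_M => R 0 i) fB; rewrite !mxE => <-.
  transitivity (\sum_(l < r) (f 0 l * (enum_val l == x)%:R + f 0 l * (enum_val l == y)%:R)).
    rewrite big_split /g /=; congr (_ + _); rewrite big_mkcond /=; apply: eq_bigr => l _;
      by case: eqP => _; rewrite ?mulr1 ?mulr0.
  apply: eq_bigr => l _; rewrite !mxE iE !inE -mulrDr -natrD; congr (_ * _%:R).
  by case: eqVneq => [->|//]; case: eqVneq => // xy; move: exy; rewrite xy eirr.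
have cl : closed e [pred x | g x == 0].
  move=> x y exy; rewrite !inE.
  by apply/idP/idP => /eqP h; move: (ge x y exy); rewrite h ?add0r ?addr0 => ->.
apply/rowP => l; rewrite mxE -gE; apply/eqP.
have := closed_connect cl (connect_root e (enum_val l)); rewrite !inE => ->.
rewrite /g big1 // => l' /eqP lE; have := enum_valP l'.
by rewrite lE inE root_root ?eqxx //; apply: sym_connect_sym.
Qed.

(** Clear the denominators and separate the positive part from the negative
    one. *)
Lemma kermx_fiber (z : 'rV[rat]_M) : z *m incidence = 0 ->
  exists a u v, [/\ a != 0, a *: z = exp_vec u - exp_vec v & deg u = deg v].
Proof.
move=> zB; pose D : int := \prod_i denq (z 0 i).
have D0 : D != 0 by apply/prodf_neq0 => i _; rewrite denq_neq0.
pose w i : int := numq (z 0 i) * \prod_(j | j != i) denq (z 0 j).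
have wE i : D%:~R * z 0 i = (w i)%:~R.
  rewrite /D (bigD1 i) //= /w !intrM -[X in _ * X](divq_num_den (z 0 i)) mulrC.
  by rewrite mulrA divfK // intq_eq0 denq_neq0.
pose u : 'X_{1..M} := [multinom (if w i is Posz l then l else 0%N) | i < M].
pose v : 'X_{1..M} := [multinom (if w i is Negz l then l.+1 else 0%N) | i < M].
have uvE : D%:~R *: z = exp_vec u - exp_vec v.
  apply/rowP => i; rewrite !mxE wE !mnmE; case: (w i) => l; first by rewrite subr0.
  by rewrite sub0r NegzE mulrNz.
exists D%:~R, u, v; split=> //; first by rewrite intq_eq0.
apply: (deg_nonroots esym eirr eA) => x xr.
have : (exp_vec u - exp_vec v) *m incidence = 0 by rewrite -uvE -scalemxAl zB scaler0.
rewrite mulmxBl !exp_vec_incidence => /rowP/(_ (enum_rank_in xr x)).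
rewrite !mxE enum_rankK_in // => /eqP; rewrite subr_eq0 => /eqP h.
by apply/eqP; rewrite -(Num.Theory.eqr_nat rat); apply/eqP.
Qed.

Section Enumeration.
Variables (n : nat) (C : 'I_n -> seq 'I_N).
Hypotheses (Cg : forall j, graph_cycle e (C j)) (Cch : forall j, chordless e (C j)).
Hypothesis Cinj : forall i j : 'I_n, C i =i C j -> i = j.
Hypothesis Csurj : forall c, graph_cycle e c -> chordless e c ->
  exists j, c =i C j.

(** The edges of the cycle, with alternating signs. *)
Definition cycle_vec j :=
  exp_vec (cycle_exp e A true (C j)) - exp_vec (cycle_exp e A false (C j)).

(** The difference of two exponents of the same degree is a circulation, along
    the edges oriented from [A] to its complement; up to sign, the difference of
    their flows is the amount which goes from [a] into [S]. *)
Definition flow (S : pred 'I_N) a m : nat :=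
  (\sum_(i < M | [exists y in S, enum_val i == [set a; y]]) m i)%N.

Lemma flowD S a m1 m2 : flow S a (m1 + m2)%MM = (flow S a m1 + flow S a m2)%N.
Proof. by rewrite /flow -big_split /=; apply: eq_bigr => i _; rewrite mnmDE. Qed.

Lemma flow0 S a : flow S a 0%MM = 0%N.
Proof. by rewrite /flow big1 // => i _; rewrite mnm0E. Qed.

Lemma flow_edge_exp S a x y : e x y ->
  flow S a (edge_exp e x y) = ((x == a) && S y + (y == a) && S x)%N.
Proof.
move=> exy; have [i iE] := edge_index exy; rewrite (edge_expE iE) /flow.
have nxy : x != y by apply: contraTneq exy => ->; rewrite eirr.
transitivity ([exists y in S, enum_val i == [set a; y]] : nat).
  rewrite big_mkcond (bigD1 i) //= mnm1E eqxx big1 ?addn0 => [|j /negPf ji].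
    by case: ifP.
  by rewrite mnm1E eq_sym ji; case: ifP.
have -> : [exists t in S, enum_val i == [set a; t]] = ((x == a) && S y) || ((y == a) && S x).
  apply/existsP/idP => [[t /andP[tS]]|].
    rewrite iE => /eqP/set2_inj[[-> ->]|[-> ->]]; first by rewrite eqxx [S t]tS.
    by rewrite eqxx [S t]tS orbT.
  case/orP=> /andP[/eqP<- tS]; [exists y|exists x]; apply/andP; split=> //; rewrite iE //.
  by rewrite setUC.
have [xa|xa] := eqVneq x a; last by [].
have [ya|ya] := eqVneq y a; first by rewrite xa ya eqxx in nxy.
by rewrite orbF addn0.
Qed.

Lemma sum_pick (T : eqType) (c : seq T) a (F : T -> nat) : uniq c -> a \in c ->
  (\sum_(x <- c) (if x == a then F x else 0) = F a)%N.
Proof.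
move=> uc ac; rewrite (bigD1_seq a) //= eqxx big1 ?addn0 // => x /negPf->//.
Qed.

Lemma flow_cycle_exp S a b c : graph_cycle e c ->
  flow S a (cycle_exp e A b c) =
  nat_of_bool ((a \in c) && (if (a \in A) == b then S (next c a) else S (prev c a))).
Proof.
move=> gc; have uc := graph_cycle_uniq gc.
rewrite cycle_exp_sum // (big_morph _ (flowD S a) (flow0 S a)).
rewrite big_seq_cond (eq_bigr (fun x =>
  ((x == a) && S (next c x) + (next c x == a) && S x)%N)); last first.
  by move=> x /andP[xc _]; rewrite flow_edge_exp // graph_cycle_next.
rewrite -big_seq_cond big_mkcond /=.
have [ac|ac] := boolP (a \in c); last first.
  rewrite big1_seq // => x /andP[_ xc].
  have -> : (x == a) = false by apply: contraNF ac => /eqP <-.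
  have -> : (next c x == a) = false by apply: contraNF ac => /eqP <-; rewrite mem_next.
  by rewrite /= if_same.
have pc : prev c a \in c by rewrite mem_prev.
pose F x : nat := if (x \in A) == b then S (next c x) : nat else 0%N.
pose G x : nat := if (x \in A) == b then S x : nat else 0%N.
transitivity (\sum_(x <- c) (if x == a then F x else 0) +
              \sum_(x <- c) (if x == prev c a then G x else 0))%N.
  rewrite -big_split /= big_seq [RHS]big_seq; apply: eq_bigr => x xc.
  rewrite -(can2_eq (prev_next uc) (next_prev uc)) /F /G.
  by case: (_ == b); case: (x == a); case: (_ == a).
rewrite !sum_pick // /F /G; have := eA (graph_cycle_prev esym gc ac).
by case: b {F G}; case: (a \in A); case: (prev c a \in A) => //= _; rewrite ?addn0.
Qed.

(** Take the flow from a vertex [a] of the cycle to the side of its successor. The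
    cycle itself leaves towards this side and returns from the other one, while
    the other chordless cycles leave and return on the same side. *)
Lemma flow_diff j : CI_graph e -> exists S a,
  (flow S a (cycle_exp e A true (C j)) != flow S a (cycle_exp e A false (C j))) /\
  forall l, l != j ->
    flow S a (cycle_exp e A true (C l)) = flow S a (cycle_exp e A false (C l)).
Proof.
move=> CI; have nb := CI_not_bridged esym eirr eA CI (Cg j) (@Cch j).
have [a ac] : exists a, a \in C j.
  by case: (C j) (Cg j) => [[]//|a t] _; exists a; rewrite inE eqxx.
exists (side e (C j) a), a; split.
  rewrite !flow_cycle_exp // ac side_next (negPf (side_prev (Cg j) ac)).
  by case: (a \in A).
move=> l lj; rewrite !flow_cycle_exp //; have [al|//] := boolP (a \in C l).
have neq : cycle_edges (C j) <> cycle_edges (C l).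
  move=> E; case/eqP: lj; apply: Cinj => x.
  have H (s t : 'I_n) : cycle_edges (C s) = cycle_edges (C t) -> x \in C s -> x \in C t.
    move=> E' xs; have : [set x; next (C s) x] \in cycle_edges (C t).
      by rewrite -E'; apply: imset_f.
    by case/(cycle_edgesP _ _ (graph_cycle_uniq (Cg t))).
  by apply/idP/idP; apply: H.
rewrite (side_chordless esym eA (Cg j) (@Cch j) ac nb (Cg l) (@Cch l) neq _ al).
  by rewrite !if_same.
exact: CI.
Qed.

Lemma cycle_vec_incidence j : cycle_vec j *m incidence = 0.
Proof.
rewrite mulmxBl !exp_vec_incidence !deg_cycle_exp //; exact: subrr.
Qed.

Lemma exp_vec_flow m (S : 'I_n -> pred 'I_N) (a : 'I_n -> 'I_N) :
  exp_vec m *m (\matrix_(i < M, j < n) [exists y in S j, enum_val i == [set a j; y]]%:R)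
  = \row_j (flow (S j) (a j) m)%:R.
Proof.
apply/rowP => j; rewrite !mxE /flow natr_sum [RHS]big_mkcond /=.
apply: eq_bigr => i _; rewrite !mxE.
by case: ifP => _; rewrite ?mulr1 ?mulr0.
Qed.

(** The flows of [flow_diff] are, up to nonzero factors, dual to the vectors of
    the chordless cycles, which are therefore linearly independent. *)
Lemma CI_chordless_le : CI_graph e -> (n + r <= M)%N.
Proof.
move=> CI; pose F : 'M[rat]_(n, M) := \matrix_j cycle_vec j.
have FB : (F <= kermx incidence)%MS.
  by apply/sub_kermxP/row_matrixP => j; rewrite row_mul rowK row0 cycle_vec_incidence.
have H j := cid (flow_diff j CI); pose S j := projT1 (H j).
have aP j := cid (projT2 (H j)); pose a j := projT1 (aP j).
have SP j := projT2 (aP j).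
have Ffree : row_free F.
  rewrite -kermx_eq0; apply/rowV0P => v /sub_kermxP vF; apply/rowP => j; rewrite mxE.
  pose L : 'M[rat]_(M, n) :=
    \matrix_(i < M, j < n) [exists y in S j, enum_val i == [set a j; y]]%:R.
  have : (v *m F *m L) 0 j = 0 by rewrite vF mul0mx mxE.
  have FL l : (F *m L) l j = (flow (S j) (a j) (cycle_exp e A true (C l)))%:R -
      (flow (S j) (a j) (cycle_exp e A false (C l)))%:R.
    transitivity ((row l (F *m L)) 0 j); first by rewrite [RHS]mxE.
    by rewrite row_mul rowK mulmxBl !exp_vec_flow !mxE.
  rewrite -mulmxA mxE (bigD1 j) //= big1 ?addr0 => [|l lj]; last first.
    by rewrite FL (proj2 (SP j) l lj) subrr mulr0.
  move/eqP; rewrite mulf_eq0 FL => /orP[/eqP//|].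
  by rewrite subr_eq0 Num.Theory.eqr_nat (negPf (proj1 (SP j))).
have := mxrankS FB; rewrite mxrank_ker rank_incidence.
move: Ffree; rewrite /row_free => /eqP->; have := rank_leq_row incidence.
rewrite rank_incidence; lia.
Qed.

Definition cycle_span (S : pred 'I_n) : 'M[rat]_(n, M) :=
  \matrix_j (if S j then cycle_vec j else 0).

Lemma cycle_vec_span (S : pred 'I_n) j : S j -> (cycle_vec j <= cycle_span S)%MS.
Proof. by move=> Sj; have := row_sub j (cycle_span S); rewrite rowK Sj. Qed.

Lemma fiber_cycle_span (S : pred 'I_n) (W : pred 'I_N) u v :
  (forall j, {in C j, forall z, W z} -> S j) ->
  deg u = deg v -> (forall x, (0 < deg u x)%N -> W x) ->
  (exp_vec u - exp_vec v <= cycle_span S)%MS.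
Proof.
move=> SW uv uW; pose R u v := is_true (exp_vec u - exp_vec v <= cycle_span S)%MS; rewrite -/(R u v).
apply: (@fiber_connected _ e A esym eirr eA W R) uv uW => {u v}.
- by move=> u; rewrite /R subrr sub0mx.
- move=> u v w uv vw; have := addmx_sub uv vw; by rewrite addrA subrK.
- by move=> w u v; rewrite /R !exp_vecD opprD addrACA subrr addr0.
move=> c gc ch cW; have [j cj] := Csurj gc ch.
have jS : S j by apply: SW => z; rewrite -cj; apply: cW.
have dc b : deg (cycle_exp e A b c) = vertices_exp (C j).
  by rewrite deg_cycle_exp //; apply/mnmP => x; rewrite !mnmE cj.
have [b1 E1] := chordless_matching esym eirr eA (Cg j) (@Cch j) (dc true).
have [b2 E2] := chordless_matching esym eirr eA (Cg j) (@Cch j) (dc false).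
rewrite /R E1 E2; case: b1 E1 => E1; case: b2 E2 => E2; rewrite ?subrr ?sub0mx //.
  exact: cycle_vec_span.
by rewrite -opprB (eqmx_opp _); apply: cycle_vec_span.
Qed.

Lemma deg_walk_exp_gt0 b x p y : path e x p -> (0 < deg (walk_exp e A b x p) y)%N ->
  y \in x :: p.
Proof.
elim: p x => [|z p IH] x /=; first by rewrite deg0 mnm0E.
case/andP=> exz pp; rewrite degD mnmDE addn_gt0 => /orP[|/(IH _ pp)]; last first.
  by move=> h; rewrite inE h orbT.
case: ifP => _; last by rewrite deg0 mnm0E.
rewrite deg_edge_exp // mnmDE !mnm1E !inE ![y == _]eq_sym.
by case: (x == y); case: (z == y).
Qed.

Fact balance_sub (a b c d s t s' t' : nat) : (a + s + t = b + s' + t' ->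
  c + s + t = d + s' + t' -> a + d = b + c)%N.
Proof. lia. Qed.

Fact balance_add (a b c d s t s' t' : nat) : (a + t' + s' = b + t + s ->
  c + s + t = d + s' + t' -> a + c = b + d)%N.
Proof. lia. Qed.

(** The ends of a bridge [p] cut the cycle into two arcs. Closing the first arc
    with [p] run backwards, and the second one with [p], gives two vectors of the
    cycle space with the cycle as their sum. Neither touches all the vertices of
    the cycle, so neither needs it in its decomposition. *)
Lemma bridged_cycle_span j : bridged e (C j) -> (cycle_vec j <= cycle_span (predC1 j))%MS.
Proof.
case=> u [v [p [uc vc nuv neuv [pp pc]]]].
have Uc := graph_cycle_uniq (Cg j).
have [k q1 q2 _ _ cE] := rot_to_arc Uc uc vc nuv.
have gc' := graph_cycle_rot k (Cg j); rewrite cE in gc'.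
have uc' := graph_cycle_uniq gc'.
have [path1 path2] : path e u (rcons q1 v) /\ path e v (rcons q2 u).
  case: gc' => /andP[cy _] _; move: cy.
  by rewrite /= rcons_cat rcons_cons -cat_rcons cat_path last_rcons => /andP[].
have [s1 [t1 q1E]] : exists s t, q1 = s :: t.
  by case: (q1) path1 => [|s t]; [rewrite /= andbT (negPf neuv)|exists s, t].
have [s2 [t2 q2E]] : exists s t, q2 = s :: t.
  by case: (q2) path2 => [|s t]; [rewrite /= andbT esym (negPf neuv)|exists s, t].
have mc z : (z \in C j) = (z \in u :: q1 ++ v :: q2) by rewrite -cE mem_rot.
pose Q b := walk_exp e A b u (rcons q1 v); pose R b := walk_exp e A b v (rcons q2 u).
pose T b := walk_exp e A b u (rcons p v).
have cycle_expE b : cycle_exp e A b (C j) = (Q b + R b)%MM.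
  by rewrite -(cycle_exp_rot e A b k) cE cycle_exp_cat.
have := deg_walk_exp eirr eA path1; have := deg_walk_exp eirr eA path2.
have := deg_walk_exp eirr eA pp; rewrite !last_rcons -/(Q _) -/(Q _) -/(R _) -/(R _) -/(T _) -/(T _).
move=> /mnmP dT /mnmP dR /mnmP dQ.
have dQT : deg (Q true + T false)%MM = deg (Q false + T true)%MM.
  rewrite !degD; apply/mnmP => z; have := dT z; have := dQ z; rewrite !mnmDE.
  exact: balance_sub.
have dRT : deg (R true + T true)%MM = deg (R false + T false)%MM.
  rewrite !degD; apply/mnmP => z; have := dT z; have := dR z; rewrite !mnmDE.
  exact: balance_add.
have -> : cycle_vec j = (exp_vec (Q true + T false)%MM - exp_vec (Q false + T true)%MM) +
                   (exp_vec (R true + T true)%MM - exp_vec (R false + T false)%MM).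
  by rewrite /cycle_vec !cycle_expE !exp_vecD; apply/rowP => i; rewrite !mxE; ring.
(* [s2] is a vertex of the second arc only, [s1] of the first *)
have s2C : s2 \in C j by rewrite mc q2E !inE !mem_cat !inE eqxx !orbT.
have s1C : s1 \in C j by rewrite mc q1E !inE eqxx !orbT.
have us2 : s2 \notin u :: rcons q1 v.
  move: uc'; rewrite q2E -cat_cons -cat_rcons cat_uniq => /and3P[_ /hasPn/(_ s2) + _].
  by rewrite inE eqxx => /(_ isT).
have us1 : s1 \notin v :: rcons q2 u.
  move: uc'; rewrite -cat_cons uniq_catC q1E cat_cons -cat_rcons -cat_cons cat_uniq.
  by case/and3P=> _ /hasPn/(_ s1) + _; rewrite inE eqxx => /(_ isT).
apply: addmx_sub.
  apply: (@fiber_cycle_span _ [pred z | z \in (u :: rcons q1 v) ++ p] _ _ _ dQT).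
    move=> l lW; apply/eqP => lj; subst l; have : s2 \in (u :: rcons q1 v) ++ p := lW _ s2C.
    rewrite mem_cat (negPf us2) /= => /pc.
    by rewrite s2C.
  move=> x; rewrite degD mnmDE addn_gt0 => h.
  suff : x \in (u :: rcons q1 v) ++ p by [].
  rewrite mem_cat; move: h.
  case/orP=> [/(deg_walk_exp_gt0 path1)->//|/(deg_walk_exp_gt0 pp)].
  rewrite !inE !mem_rcons !inE => /or3P[->|->|->]; rewrite ?orbT //.
apply: (@fiber_cycle_span _ [pred z | z \in (v :: rcons q2 u) ++ p] _ _ _ dRT).
  move=> l lW; apply/eqP => lj; subst l; have : s1 \in (v :: rcons q2 u) ++ p := lW _ s1C.
  rewrite mem_cat (negPf us1) /= => /pc.
  by rewrite s1C.
move=> x; rewrite degD mnmDE addn_gt0 => h.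
suff : x \in (v :: rcons q2 u) ++ p by [].
rewrite mem_cat; move: h.
case/orP=> [/(deg_walk_exp_gt0 path2)->//|/(deg_walk_exp_gt0 pp)].
rewrite !inE !mem_rcons !inE => /or3P[->|->|->]; rewrite ?orbT //.
Qed.

(** The cycle space is spanned by the chordless cycles even without the bridged
    one, so there are more of them than its dimension. *)
Lemma bridged_chordless_gt j : bridged e (C j) -> (M < n + r)%N.
Proof.
move=> /bridged_cycle_span jS.
have sub : (kermx incidence <= cycle_span (predC1 j))%MS.
  apply/row_subP => i; have /kermx_fiber : row i (kermx incidence) *m incidence = 0.
    by apply/sub_kermxP; rewrite row_sub.
  case=> a [u [v [a0 aE uv]]]; rewrite -(eqmx_scale _ a0) aE.
  have /submx_trans : (exp_vec u - exp_vec v <= cycle_span predT)%MS.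
    exact: (@fiber_cycle_span _ predT _ _ _ uv).
  apply; apply/row_subP => l; rewrite rowK.
  have [->|lj] := eqVneq l j; first exact: jS.
  exact: cycle_vec_span.
have lt_n : (\rank (cycle_span (predC1 j)) < n)%N.
  rewrite ltn_neqAle rank_leq_row andbT -/(row_free _) -kermx_eq0.
  apply/rowV0Pn; exists (delta_mx 0 j).
    by apply/sub_kermxP; rewrite -rowE rowK /= eqxx.
  by apply/eqP => /rowP/(_ j); rewrite !mxE !eqxx => /eqP; rewrite oner_eq0.
have := leq_ltn_trans (mxrankS sub) lt_n.
rewrite mxrank_ker rank_incidence => h.
have rM : (r <= M)%N by rewrite -rank_incidence rank_leq_row.
by rewrite addnC -ltn_subLR.
Qed.

End Enumeration.

Lemma chordless_enumeration : exists n (C : 'I_n -> seq 'I_N),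
  [/\ forall j, graph_cycle e (C j), forall j, chordless e (C j),
      forall i j : 'I_n, C i =i C j -> i = j &
      forall c, graph_cycle e c -> chordless e c -> exists j, c =i C j].
Proof.
pose V := [set W : {set 'I_N} | `[< exists c,
  [/\ graph_cycle e c, chordless e c & [set x in c] = W] >]].
have VP (j : 'I_#|V|) : exists c,
    [/\ graph_cycle e c, chordless e c & [set x in c] = enum_val j].
  by have := enum_valP j; rewrite inE => /asboolP.
pose C j := projT1 (cid (VP j)).
have CP j : [/\ graph_cycle e (C j), chordless e (C j) & [set x in C j] = enum_val j].
  exact: (projT2 (cid (VP j))).
exists #|V|, C; split=> [j|j|i j Cij|c gc ch]; try by case: (CP j).
  apply: enum_val_inj; case: (CP i) => _ _ <-; case: (CP j) => _ _ <-.
  by apply/setP => x; rewrite !inE Cij.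
have cV : [set x in c] \in V by rewrite inE; apply/asboolP; exists c.
exists (enum_rank_in cV [set x in c]) => x.
have [_ _ /setP/(_ x)] := CP (enum_rank_in cV [set x in c]).
by rewrite enum_rankK_in // !inE.
Qed.

End CycleSpace.

(** * Complete intersections and CI graphs *)

Lemma bridged_eqi (N : nat) (e : rel 'I_N) c c' : c =i c' -> bridged e c -> bridged e c'.
Proof.
move=> cc [u [v [p [uc vc nuv neuv [pp pc]]]]]; exists u, v, p.
by rewrite -!cc; split=> //; split=> // z /pc; rewrite cc.
Qed.

Theorem theorem3p5 (k : fieldType) (N : nat) (e : rel 'I_N)
    (He : simple_graph e) (Hbip : bipartite e) :
  complete_intersection k e <-> CI_graph e.
Proof.
have [esym eirr] := He; have [A eA] := Hbip.
have [n [C [Cg Cch Cinj Csurj]]] := chordless_enumeration e.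
have rM : (#|nonroots e| <= #|edges e|)%N.
  by rewrite -(rank_incidence esym eirr) rank_leq_row.
split=> [[d [h [[_ dmax] hd [s sgen]]]]|CI].
  have nh := chordless_le_generators esym eirr eA Cg Cch Cinj sgen.
  have rd : (#|nonroots e| <= d)%N.
    by have [P /dmax] := krull_chain esym eirr k.
  move=> c1 c2 g1 ch1 g2 ch2 neq; rewrite leqNgt; apply/negP => lt1.
  have b1 := shared_edges_bridged esym eirr g1 ch1 g2 ch2 neq lt1.
  have [j cj] := Csurj _ g1 ch1.
  have := bridged_chordless_gt esym eirr eA Cg Cch Csurj (bridged_eqi cj b1).
  by rewrite -hd ltnNge leq_add.
exists #|nonroots e|, (#|edges e| - #|nonroots e|)%N; split.
- exact: (krull_dim_edge_alg esym eirr eA k).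
- by rewrite subnK.
exists (cycle_generators e A k C (#|edges e| - #|nonroots e|)).
apply: (cycle_generators_generate esym eirr eA Cg Cch Csurj).
rewrite leq_subRL // addnC.
exact: (CI_chordless_le esym eirr eA Cg Cch Cinj CI).
Qed.
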